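(* Let $D$ be a non-empty, bounded, open interval in $\mathbb{R}$ (case $d=1$) or a non-empty, bounded, connected $C^{1,1}$ open set in $\mathbb{R}^d$ with $d\ge 2$. Let $X=(X_t)_{t\in[0,1]}$ be a stochastic process in $\mathbb{R}^d$ whose components are i.i.d. zero-mean Gaussian processes with càdlàg paths starting at the origin and common variance function $R_t$ under the probability measure $\mathbb{P}=\mathbb{P}_0$, such that $X_t$ is non-degenerate for all $t\in(0,1]$. Then $$\lim_{t\downarrow 0}\frac{|D|-H^X_D(t)}{\sqrt{R_t}}=\frac{|\partial D|}{\sqrt{2\pi}}.$$
   Context: A real-valued process is a Gaussian process if all its finite-dimensional distributions are (multivariate) Gaussian. The process $X$ is the coordinate process on the space $\mathbb{D}[0,1]$ of $\mathbb{R}^d$-valued càdlàg functions on $[0,1]$, equipped with the Borel $\sigma$-algebra of the Skorokhod $J_1$ topology (equivalently, the $\sigma$-algebra generated by coordinate projections), under a probability measure $\mathbb{P}=\mathbb{P}_0$ with $\mathbb{P}(X_0=0)=1$. The common variance function is $R_t=\mathbb{E}[(X^1_t)^2]$, where $X^1$ is the first component. Non-degenerate means $\mathbb{P}(X_t\neq 0)>0$ (equivalently here $R_t>0$). For $x\in D$, $\mathbb{P}_x(F):=\mathbb{P}(F-x)$ with $F-x=\{\omega:\omega(\cdot)+x\in F\}$; that is, $X$ under $\mathbb{P}_x$ has the law of $x+X$ under $\mathbb{P}$. The regular heat content is $$H^X_D(t):=\int_D\mathbb{P}_x(X_t\in D)\,dx,\qquad t\in(0,1].$$ $|D|$ is the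 $d$-dimensional Lebesgue measure of $D$ and $|\partial D|$ is the $(d-1)$-dimensional Lebesgue (surface) measure of $\partial D$; if $D=(a,b)\subset\mathbb{R}$, then $|D|=b-a$ and $|\partial D|=2$. An open set $D\subset\mathbb{R}^d$ ($d\ge2$) is $C^{1,1}$ if there exist $R_1>0$ and $\Lambda>0$ such that for every $z\in\partial D$ there exist a $C^{1,1}$ function $\phi=\phi_z:\mathbb{R}^{d-1}\to\mathbb{R}$ and an orthonormal coordinate system $CS_z$: $y=(\tilde y,y^d)\in\mathbb{R}^{d-1}\times\mathbb{R}$ with origin at $z$ such that $\phi(0)=0$, $\nabla\phi(0)=0$, $\|\nabla\phi\|_\infty\le\Lambda$, $|\nabla\phi(x_1)-\nabla\phi(x_2)|\le\Lambda|x_1-x_2|$ for all $x_1,x_2\in\mathbb{R}^{d-1}$, and $B(z,R_1)\cap D=B(z,R_1)\cap\{y=(\tilde y,y^d)\text{ in }CS_z: y^d>\phi(\tilde y)\}$. This is equivalent to the uniform interior and exterior ball condition: there is $R>0$ such that for every $z\in\partial D$ there are open balls $B_1,B_2$ of radius $R$ with $B_1\subset D$, $B_2\subset\mathbb{R}^d\setminus\overline D$ and $\partial B_1\cap\partial B_2=\{z\}$. *)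

(* Defs.v *)
From HB Require Import structures.
From mathcomp Require Import all_boot all_order all_algebra.
From mathcomp Require Import all_classical all_reals all_analysis.

Set Implicit Arguments.
Unset Strict Implicit.
Unset Printing Implicit Defensive.

Import Order.TTheory GRing.Theory Num.Theory.
Import numFieldNormedType.Exports.

Local Open Scope classical_set_scope.
Local Open Scope ring_scope.

(** * Lebesgue measure on R^n *)

Section measurable_rV.
Context {R : realType} (n : nat).

(* The sigma-algebra generated by the coordinate projections. *)
Let coords : 'I_n -> 'rV[R]_n -> R := fun i x => x 0 i.

Let rV_set0 : g_sigma_preimage coords set0.
Proof. exact: sigma_algebra0. Qed.

Let rV_setC A : g_sigma_preimage coords A -> g_sigma_preimage coords (~` A).
Proof. exact: sigma_algebraC. Qed.

Let rV_bigcup (F : _^nat) : (forall i, g_sigma_preimage coords (F i)) ->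
  g_sigma_preimage coords (\bigcup_i (F i)).
Proof. exact: sigma_algebra_bigcup. Qed.

HB.instance Definition _ := @isMeasurable.Build default_measure_display
  ('rV[R]_n) (g_sigma_preimage coords) rV_set0 rV_setC rV_bigcup.

End measurable_rV.

Section measurable_rV_lemmas.
Context {R : realType}.

Lemma measurable_coord n (i : 'I_n) :
  measurable_fun [set: 'rV[R]_n] (fun x => x 0 i : R).
Proof.
move=> _ Y mY; rewrite setTI; apply: sub_sigma_algebra => /=.
rewrite -bigcup_seq/=; exists i => /=; first by rewrite mem_index_enum.
by exists Y => //; rewrite setTI.
Qed.

Lemma measurable_fun_rVP d (T : measurableType d) n (f : T -> 'rV[R]_n) :
  measurable_fun [set: T] f <->
  forall i, measurable_fun [set: T] (fun t => f t 0 i : R).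
Proof.
split=> [mf i|mf]; first exact: (measurableT_comp (measurable_coord i) mf).
move=> _ A; rewrite setTI.
suff : g_sigma_preimage (fun (i : 'I_n) (x : 'rV[R]_n) => x 0 i : R) `<=`
    [set B | measurable (f @^-1` B)] by exact.
apply: smallest_sub.
  split => /=.
  - by rewrite preimage_set0.
  - by move=> B mB; rewrite setTD preimage_setC; exact: measurableC.
  - by move=> F mF; rewrite preimage_bigcup; exact: bigcup_measurable.
clear A; case: n f mf => [|n] f mf; first by rewrite big_ord0.
rewrite -bigcup_mkord_ord; apply: bigcup_sub => i _ B [C mC <-] /=.
by rewrite setTI -[X in measurable X]setTI; exact: (mf (inord i) measurableT C mC).
Qed.

Definition rV_cons n (p : R * 'rV[R]_n) : 'rV[R]_n.+1 :=
  \row_i oapp (p.2 0) p.1 (unlift ord0 i).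

Lemma rV_cons0 n (p : R * 'rV[R]_n) : rV_cons p 0 ord0 = p.1.
Proof. by rewrite mxE unlift_none. Qed.

Lemma rV_consS n (p : R * 'rV[R]_n) j : rV_cons p 0 (lift ord0 j) = p.2 0 j.
Proof. by rewrite mxE liftK. Qed.

Lemma measurable_rV_cons n : measurable_fun [set: R * 'rV[R]_n] (@rV_cons n).
Proof.
apply/measurable_fun_rVP => i; case: (unliftP ord0 i) => [j ->|->].
  under eq_fun do rewrite rV_consS.
  exact: (measurableT_comp (measurable_coord j) measurable_snd).
under eq_fun do rewrite rV_cons0.
exact: measurable_fst.
Qed.

End measurable_rV_lemmas.

Section lebesgue_rV.
Context {R : realType}.
Local Open Scope ereal_scope.

Section step.
Context n (m : {sigma_finite_measure set 'rV[R]_n -> \bar R}).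

Definition lebesgue_step (A : set 'rV[R]_n.+1) : \bar R :=
  (@lebesgue_measure R \x m) (@rV_cons R n @^-1` A).

Let mcons (A : set 'rV[R]_n.+1) :
  measurable A -> measurable (@rV_cons R n @^-1` A).
Proof.
by move=> mA; rewrite -[X in measurable X]setTI; exact: measurable_rV_cons.
Qed.

Let lebesgue_step0 : lebesgue_step set0 = 0.
Proof. by rewrite /lebesgue_step preimage_set0 measure0. Qed.

Let lebesgue_step_ge0 A : 0 <= lebesgue_step A.
Proof. exact: measure_ge0. Qed.

Let lebesgue_step_sigma_additive : semi_sigma_additive lebesgue_step.
Proof.
move=> F mF tF mUF; rewrite /lebesgue_step preimage_bigcup.
apply: measure_semi_sigma_additive.
- by move=> k; exact: mcons.
- by apply/trivIsetP => i j _ _ ij; rewrite -preimage_setI; move/trivIsetP : tF => ->; rewrite ?preimage_set0.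
- by rewrite -preimage_bigcup; exact: mcons.
Qed.

HB.instance Definition _ := isMeasure.Build _ _ _ lebesgue_step
  lebesgue_step0 lebesgue_step_ge0 lebesgue_step_sigma_additive.

Let lebesgue_step_sigma_finite : sigma_finite setT lebesgue_step.
Proof.
have /sigma_finiteP[F [TF ndF Foo]] := sigma_finiteT (@lebesgue_measure R).
have /sigma_finiteP[G [TG ndG Goo]] := sigma_finiteT m.
pose un (x : 'rV[R]_n.+1) : R * 'rV[R]_n :=
  (x 0%R ord0, \row_j x 0%R (lift ord0 j)).
have mun : measurable_fun [set: 'rV[R]_n.+1] un.
  apply/measurable_fun_pairP; split; first exact: measurable_coord.
  apply/measurable_fun_rVP => i /=; rewrite /comp /=.
  by under eq_fun do rewrite mxE; exact: measurable_coord.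
have unK : cancel (@rV_cons R n) un.
  move=> [a v]; rewrite /un rV_cons0; congr pair.
  by apply/rowP => j; rewrite mxE rV_consS.
exists (fun k => un @^-1` (F k `*` G k)).
  apply/esym; rewrite -subTset => x _.
  have [i _ Fi] : (\bigcup_k F k) (un x).1 by rewrite -TF.
  have [j _ Gj] : (\bigcup_k G k) (un x).2 by rewrite -TG.
  exists (maxn i j) => //; split.
    by move: Fi; exact/subsetPset/ndF/leq_maxl.
  by move: Gj; exact/subsetPset/ndG/leq_maxr.
move=> k; have [mF Fk] := Foo k; have [mG Gk] := Goo k; split.
  by rewrite -[X in measurable X]setTI; apply: mun => //; exact: measurableX.
rewrite /lebesgue_step -comp_preimage.
rewrite (_ : un \o _ = id); last by apply/funext => x /=; rewrite unK.
by rewrite preimage_id product_measure1E// lte_mul_pinfty// ge0_fin_numE.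
Qed.

HB.instance Definition _ := @Measure_isSigmaFinite.Build _ _ _
  lebesgue_step lebesgue_step_sigma_finite.

End step.

Fixpoint lebesgue_rV n : {sigma_finite_measure set 'rV[R]_n -> \bar R} :=
  match n with
  | 0%N => \d_(0%R : 'rV[R]_0)
  | n'.+1 => lebesgue_step (lebesgue_rV n')
  end.

Lemma lebesgue_rV_box n (A : 'I_n -> set R) :
  (forall i, measurable (A i)) ->
  lebesgue_rV n [set x : 'rV[R]_n | forall i, A i (x 0%R i)] =
  \prod_(i < n) lebesgue_measure (A i).
Proof.
elim: n A => [|n ih] A mA.
  rewrite big_ord0 /= diracE mem_set//; by case.
rewrite big_ord_recl -ih //= /lebesgue_step.
rewrite -product_measure1E //; last first.
  rewrite (_ : [set _ | _] = \bigcap_(i in [set: 'I_n])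
     [set x : 'rV[R]_n | A (lift ord0 i) (x 0%R i)]).
    apply: fin_bigcap_measurable => // i _.
    rewrite -[X in measurable X]setTI.
    exact: measurable_coord.
  by apply/seteqP; split => x Ax i; [move=> _; exact: Ax|exact: (Ax i I)].
  exact: mA.
apply: (congr1 (product_measure1 _ _)); apply/seteqP; split => -[a v] /=.
  move=> Aav; split; first by have := Aav ord0; rewrite rV_cons0.
  by move=> i; have := Aav (lift ord0 i); rewrite rV_consS.
move=> [Aa Av] i; case: (unliftP ord0 i) => [j ->|->].
  by rewrite rV_consS; exact: Av.
by rewrite rV_cons0.
Qed.

End lebesgue_rV.

(** * C^{1,1} open sets and their surface area *)

Section domains.
Context {R : realType}.

(* The library norm on 'rV[R]_n is the sup norm. *)
Definition enorm n (x : 'rV[R]_n) : R := Num.sqrt (\sum_i x 0 i ^+ 2).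

Definition eball n (z : 'rV[R]_n) (r : R) : set 'rV[R]_n :=
  [set x | enorm (x - z) < r].

Definition frontier n (D : set 'rV[R]_n) : set 'rV[R]_n :=
  closure D `\` interior D.

Definition grad n (phi : 'rV[R]_n -> R) (u : 'rV[R]_n) : 'rV[R]_n :=
  \row_i 'D_(delta_mx 0 i) phi u.

Definition C11_function n (Lambda : R) (phi : 'rV[R]_n -> R) :=
  [/\ forall u, differentiable phi u,
      forall u, enorm (grad phi u) <= Lambda &
      forall u v, enorm (grad phi u - grad phi v) <= Lambda * enorm (u - v)].

(* The point with coordinates (u, h) in the coordinate system with origin z
   whose orthonormal basis consists of the rows of Q. *)
Definition chart_point n (z : 'rV[R]_n.+1) (Q : 'M[R]_n.+1)
    (u : 'rV[R]_n) (h : R) : 'rV[R]_n.+1 :=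
  z + (\row_j oapp (u 0) h (unlift ord_max j)) *m Q.

Definition C11_chart n (D : set 'rV[R]_n.+1) (r Lambda : R) (z : 'rV[R]_n.+1)
    (Q : 'M[R]_n.+1) (phi : 'rV[R]_n -> R) :=
  [/\ Q *m Q^T = 1%:M,
      C11_function Lambda phi,
      phi 0 = 0,
      grad phi 0 = 0 &
      eball z r `&` D =
      eball z r `&` [set x | exists u h, phi u < h /\ x = chart_point z Q u h]].

Definition C11_open n (D : set 'rV[R]_n.+1) :=
  open D /\
  exists r Lambda, [/\ 0 < r, 0 < Lambda &
    forall z, frontier D z -> exists Q phi, C11_chart D r Lambda z Q phi].

(* The surface integral of chi over the graph of phi. *)
Definition chart_integral n (z : 'rV[R]_n.+1) (Q : 'M[R]_n.+1)
    (phi : 'rV[R]_n -> R) (chi : 'rV[R]_n.+1 -> R) : \bar R :=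
  (\int[lebesgue_rV n]_u
     (chi (chart_point z Q u (phi u)) *
      Num.sqrt (1 + enorm (grad phi u) ^+ 2))%:E)%E.

(* s is the area of the boundary of D computed from finitely many charts and a
   continuous partition of unity subordinate to them. *)
Definition area_by_charts n (D : set 'rV[R]_n.+1) (s : \bar R) :=
  exists (k : nat) (r Lambda : 'I_k -> R) (z : 'I_k -> 'rV[R]_n.+1)
    (Q : 'I_k -> 'M[R]_n.+1) (phi : 'I_k -> 'rV[R]_n -> R)
    (chi : 'I_k -> 'rV[R]_n.+1 -> R),
  [/\ forall i, [/\ 0 < r i, 0 < Lambda i, frontier D (z i) &
                    C11_chart D (r i) (Lambda i) (z i) (Q i) (phi i)],
      forall i, [/\ continuous (chi i), forall x, 0 <= chi i x &
                    closure [set x | chi i x != 0] `<=` eball (z i) (r i)],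
      forall x, frontier D x -> \sum_i chi i x = 1 &
      s = (\sum_i chart_integral (z i) (Q i) (phi i) (chi i))%E].

(* The value does not depend on the charts or on the partition of unity, and
   these exist when D is bounded and C11_open. *)
Definition surface_area n (D : set 'rV[R]_n.+1) : \bar R :=
  xget 0%E (area_by_charts D).

(* In dimension one the domains are the bounded intervals, and |∂D| = 2. *)
Definition boundary_measure n (D : set 'rV[R]_n.+1) : \bar R :=
  if n is 0%N then 2%:E else surface_area D.

(* The ambient dimension is n.+1. *)
Definition admissible_domain n (D : set 'rV[R]_n.+1) :=
  (n = 0%N /\ exists a b : R, a < b /\ D = [set x | a < x 0 ord0 < b]) \/
  ((0 < n)%N /\ [/\ D !=set0, bounded_set D, connected D & C11_open D]).

End domains.

(** * Gaussian processes *)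

Section processes.
Context {R : realType} (d : measure_display) (Omega : measurableType d)
  (P : probability Omega R).

(* The normal law with mean m and variance s ^+ 2, a Dirac mass when s = 0;
   normal_prob m 0 is not that Dirac mass. *)
Definition gaussian_law (m s : R) (A : set R) : \bar R :=
  if s == 0 then \d_m A else normal_prob m s A.

Definition gaussian_rv (Y : Omega -> R) :=
  measurable_fun setT Y /\
  exists m s : R, forall A, measurable A -> P (Y @^-1` A) = gaussian_law m s A.

(* A random vector is Gaussian, possibly degenerate, when all the linear
   combinations of its components are. *)
Definition gaussian_process (Y : R -> Omega -> R) :=
  forall (k : nat) (t a : 'I_k -> R), (forall i, 0 <= t i <= 1) ->
  gaussian_rv (fun w => \sum_i a i * Y (t i) w).

Definition zero_mean (Y : R -> Omega -> R) :=
  forall t : R, 0 <= t <= 1 -> ('E_P[Y t] = 0)%E.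

(* The sigma-algebra on paths generated by the projections at times in
   [0, 1]; values of the paths outside [0, 1] are irrelevant. *)
Definition path_measurable : set (set (R -> R)) :=
  <<s [set C | exists t A, [/\ 0 <= t <= 1, measurable A &
                               C = [set f : R -> R | A (f t)]]] >>.

Definition identically_distributed (I : Type) (Y : I -> R -> Omega -> R) :=
  forall i j F, path_measurable F ->
    P [set w | F (fun t => Y i t w)] = P [set w | F (fun t => Y j t w)].

Definition independent_processes (k : nat) (Y : 'I_k -> R -> Omega -> R) :=
  forall F : 'I_k -> set (R -> R), (forall i, path_measurable (F i)) ->
    P [set w | forall i, F i (fun t => Y i t w)] =
    (\prod_i P [set w | F i (fun t => Y i t w)])%E.

Definition cadlag n (x : R -> 'rV[R]_n) :=
  (forall t : R, 0 <= t < 1 -> x s @[s --> t^'+] --> x t) /\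
  (forall t : R, 0 < t <= 1 -> cvg (x s @[s --> t^'-])).

Definition component n (X : R -> Omega -> 'rV[R]_n) (i : 'I_n) :
    R -> Omega -> R :=
  fun t w => X t w 0 i.

Definition variance_function n (X : R -> Omega -> 'rV[R]_n.+1) (t : R) : R :=
  fine ('E_P[fun w => (component X ord0 t w ^+ 2)%R])%E.

(* The law of X under P_x is the law of x + X under P. *)
Definition heat_content n (D : set 'rV[R]_n) (X : R -> Omega -> 'rV[R]_n)
    (t : R) : \bar R :=
  (\int[lebesgue_rV n]_(x in D) P [set w | D (x + X t w)%R])%E.

End processes.

(* Main.v *)
(* Writing s_t for the square root of R_t, X_t has the law of s_t Z with Z a
   standard normal vector, and Fubini gives |D| - H(t) = E G(s_t Z), where
   G(y) = |{x in D : x + y notin D}|. Moreover s_t -> 0 since X is right-continuous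
   at 0 and X_0 = 0.
   A segment from x in D to x + y notin D meets the boundary, so for small y only a
   neighbourhood of the boundary matters, where D is the region above the graph of
   a C^{1,1} function phi. There {x in D : x + y notin D} is a layer above the graph
   whose height over u is the positive part of phi (u + y') - y_n - phi u. Hence
   G(y) <= C |y|, and G(s y) / s converges as s -> 0 to the flux of y through the
   boundary, the integral of (y . nu)^+ for the unit outer normal nu. By dominated
   convergence (|D| - H(t)) / s_t tends to the integral of E (Z . nu)^+ over the
   boundary, and E (Z . nu)^+ = 1 / sqrt (2 pi) by rotation invariance of Z. *)
Require Import Defs.
From HB Require Import structures.
From mathcomp Require Import all_boot all_order all_algebra.
From mathcomp Require Import finmap all_classical all_reals all_analysis.
From mathcomp Require Import measurable_realfun.
From mathcomp Require Import ring lra.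

Set Implicit Arguments.
Unset Strict Implicit.
Unset Printing Implicit Defensive.

Import Order.TTheory GRing.Theory Num.Theory.
Import numFieldNormedType.Exports.

Local Open Scope classical_set_scope.
Local Open Scope ring_scope.

(** * Lebesgue measure on R^n *)

(** Three obstacles shape the proof. The area is a value computed from some charts and a partition
    of unity. The limit is proved for every value so obtained, through volumes weighted by the
    partition, and is applied to the value picked by [xget] once charts have been built; an interval
    gets charts over R^0. The weights sum to 1 on the boundary only, so the weighted volumes match
    [G] up to a relative error that tends to 0 with the translation. [lebesgue_rV] is an iterated
    product, which hides its rotation invariance. This is derived from the Gaussian density, a
    product that depends only on the Euclidean norm. [R_t] is the mean of an unbounded function, so
    its limit does not follow from path continuity alone; a bounded test function gives it. The
    vector [Z] is [X 1] over its standard deviation and lives on [Omega] itself. Dominated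
    convergence acts on sequences, so limits are taken along sequences of times, and the right limit
    is recovered at the end. *)

Section rV_measurability.
Context {R : realType}.

(** The balls of the library norm are boxes, and boxes lie in the sigma-algebra of the coordinates;
    countably many of them, with rational centres and radii [1 / (k + 1)], exhaust an open set. *)
Lemma open_measurable_rV n (U : set 'rV[R]_n) : open U -> measurable U.
Proof.
move=> oU.
pose B (p : 'rV[rat]_n * nat) : set 'rV[R]_n :=
  [set y | forall i, `|y 0 i - ratr (p.1 0 i)| < p.2.+1%:R^-1].
have mB p : measurable (B p).
  rewrite (_ : B p = \bigcap_(i in [set: 'I_n])
     [set y : 'rV[R]_n | `|y 0 i - ratr (p.1 0 i)| < p.2.+1%:R^-1]); last first.
    by apply/seteqP; split => y yB i; [move=> _; exact: yB|exact: (yB i I)].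
  apply: fin_bigcap_measurable => // i _.
  have mi : measurable_fun [set: 'rV[R]_n] (fun y => `|y 0 i - ratr (p.1 0 i)|).
    by apply: measurableT_comp => //; apply: measurable_funB => //; exact: measurable_coord.
  rewrite [X in measurable X](_ : _ = setT `&`
     (fun y : 'rV[R]_n => `|y 0 i - ratr (p.1 0 i)|) @^-1` `]-oo, p.2.+1%:R^-1[).
    by apply: mi.
  by rewrite setTI; apply/seteqP; split => y /=; rewrite in_itv.
suff -> : U = \bigcup_(p in [set p | B p `<=` U]) B p.
  rewrite bigcup_mkcond; apply: countable_bigcupT_measurable => [|p].
    exact: countableP.
  by case: ifPn.
apply/seteqP; split => [x Ux|x [p /= pU Bx]]; last exact: pU.
have [e /= e0 eU] : nbhs_ball x U by rewrite nbhs_ballE; exact: open_nbhs_nbhs.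
(* The box is centred at a rational point near [x], so its points are within two radii of [x]; hence
   half of [e]. *)
have [k ke] : exists k, k.+1%:R^-1 < e / 2.
  have [k _ hk] := @near_infty_natSinv_lt R (PosNum (divr_gt0 e0 (ltr0n R 2))).
  by exists k; exact: (hk k (leqnn _)).
have /choice[q qx] : forall i : 'I_n, exists q : rat, `|x 0 i - ratr q| < k.+1%:R^-1.
  move=> i.
  have k0 : 0 < k.+1%:R^-1 :> R by rewrite invr_gt0.
  have xk : x 0 i - k.+1%:R^-1 < x 0 i + k.+1%:R^-1.
    by rewrite ltrBlDr -addrA ltrDl addr_gt0.
  have [q] := rat_in_itvoo xk.
  by rewrite in_itv/= => qi; exists q; rewrite distrC ltr_distl.
exists (\row_i q i, k); last by move=> i /=; rewrite mxE; exact: qx.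
move=> y /= By; apply: eU; split=> // i j; rewrite (ord1 i).
rewrite -ball_normE /ball_/=.
rewrite (le_lt_trans (ler_distD (ratr (q j)) _ _))// (splitr e).
rewrite ltrD// ?(lt_trans (qx j) ke)//.
by rewrite distrC; have := By j; rewrite mxE => /lt_trans; exact.
Qed.

Lemma continuous_measurable_rV n (f : 'rV[R]_n -> R) :
  continuous f -> measurable_fun setT f.
Proof.
move=> /continuousP cf.
apply: (measurability _ (RGenOpens.measurableE R)).
move=> _ [_ [a [b ->]] <-].
by rewrite setTI; apply: open_measurable_rV; apply: cf.
Qed.

End rV_measurability.

(** * Invariance of Lebesgue measure under translations and point reflections *)

Section lebesgue_rV_invariance.
Context {R : realType}.
Local Open Scope ereal_scope.

(** Slopes 1 and -1 preserve the lengths of half-open intervals, and these determine Lebesgue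
    measure. *)
Lemma ge0_integral_affine (e a : R) (f : R -> \bar R) :
  (e = 1 \/ e = -1)%R -> measurable_fun setT f -> (forall x, 0 <= f x) ->
  \int[lebesgue_measure]_h f (e * h + a)%R = \int[lebesgue_measure]_h f h.
Proof.
move=> e1 mf f0.
pose phi (h : measurableTypeR R) : measurableTypeR R := (e * h + a)%R.
have mphi : measurable_fun setT phi.
  by apply: measurable_funD => //; exact: measurable_funM.
transitivity (\int[pushforward (@lebesgue_measure R) phi]_h f h).
  by rewrite (ge0_integral_pushforward mphi _ measurableT).
apply: eq_measure_integral => A mA _.
apply/esym/lebesgue_measure_unique => // _ [[x y]] _ <-.
change (lebesgue_measure `]x, y]%classic =
  @lebesgue_measure R (phi @^-1` `]x, y]%classic)).
(* For the slope -1 the preimage is closed on the left and open on the right. *)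
have -> : phi @^-1` `]x, y] = if e == 1%R then `](x - a)%R, (y - a)%R]%classic
    else `[(a - y)%R, (a - x)%R[%classic.
  have /negbTE N11 : (-1 != 1 :> R)%R by apply/eqP; lra.
  rewrite /phi; case: e1 => ->; rewrite ?eqxx ?N11;
    apply/seteqP; split=> h /=; rewrite !in_itv/= => /andP[? ?];
    apply/andP; split; lra.
case: ifP => _; rewrite !lebesgue_measure_itv/= !lte_fin.
  by rewrite ltrD2r; case: ifP => // _; rewrite -!EFinB; congr EFin; ring.
by rewrite ltrD2l ltrN2; case: ifP => // _; rewrite -!EFinB; congr EFin; ring.
Qed.

(** By construction [lebesgue_rV n.+1] is the image of a product measure under [rV_cons], so this is
    Tonelli with the new coordinate innermost. *)
Lemma ge0_integral_rV_cons n (f : 'rV[R]_n.+1 -> \bar R) :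
  measurable_fun setT f -> (forall x, 0 <= f x) ->
  \int[lebesgue_rV n.+1]_x f x =
  \int[lebesgue_rV n]_u \int[lebesgue_measure]_h f (rV_cons (h, u)).
Proof.
move=> mf f0.
have mc : measurable_fun [set: measurableTypeR R * 'rV[R]_n] (@rV_cons R n).
  exact: measurable_rV_cons.
transitivity (\int[pushforward (@lebesgue_measure R \x lebesgue_rV n) (@rV_cons R n)]_x f x).
  by apply: eq_measure_integral.
rewrite (ge0_integral_pushforward mc _ measurableT)//=.
rewrite preimage_setT fubini_tonelli2//.
exact: measurableT_comp.
Qed.

Lemma measurable_rV_cons_section n (f : 'rV[R]_n.+1 -> \bar R) :
  measurable_fun setT f -> (forall x, 0 <= f x) ->
  measurable_fun setT (fun u => \int[lebesgue_measure]_h f (rV_cons (h, u))).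
Proof.
move=> mf f0.
have mc : measurable_fun [set: measurableTypeR R * 'rV[R]_n] (@rV_cons R n).
  exact: measurable_rV_cons.
apply: (@measurable_fun_fubini_tonelli_G _ _ _ _ _ lebesgue_measure
  (f \o @rV_cons R n)); last by move=> p /=.
exact: measurableT_comp.
Qed.

Lemma measurable_rV_affine n (e : R) (a : 'rV[R]_n) :
  measurable_fun setT (fun x : 'rV[R]_n => (e *: x + a)%R).
Proof.
apply/measurable_fun_rVP => i.
under eq_fun do rewrite !mxE.
by apply: measurable_funD => //; apply: measurable_funM => //; exact: measurable_coord.
Qed.

(** Induction on the dimension. Slope 1 gives translations, and slope -1 the substitution
    [y -> x - y] of the convolution argument below. *)
Lemma ge0_integral_rV_affine n (e : R) (a : 'rV[R]_n) (f : 'rV[R]_n -> \bar R) :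
  (e = 1 \/ e = -1)%R -> measurable_fun setT f -> (forall x, 0 <= f x) ->
  \int[lebesgue_rV n]_x f (e *: x + a)%R = \int[lebesgue_rV n]_x f x.
Proof.
move=> e1; elim: n a f => [|n IHn] a f mf f0.
  by apply: eq_integral => x _; congr f; apply/rowP => -[].
pose a' := (\row_j a 0 (lift ord0 j))%R.
have fE h u : f (e *: rV_cons (h, u) + a)%R =
    f (rV_cons (e * h + a 0 ord0, e *: u + a'))%R.
  congr f; apply/rowP => i; rewrite !mxE.
  by case: (unliftP ord0 i) => [j ->|->] /=; rewrite ?mxE.
rewrite ge0_integral_rV_cons//; last first.
  by apply: measurableT_comp => //; exact: measurable_rV_affine.
under eq_integral do under eq_integral do rewrite fE.
rewrite [RHS]ge0_integral_rV_cons//.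
rewrite -[RHS](IHn a')//; last 2 first.
- exact: measurable_rV_cons_section.
- by move=> u; apply: integral_ge0.
apply: eq_integral => u _.
apply: (@ge0_integral_affine e (a 0%R ord0) (fun h => f (rV_cons (h, e *: u + a')%R))) => //.
apply: measurableT_comp => //; apply: measurableT_comp; first exact: measurable_rV_cons.
exact: pair2_measurable.
Qed.

End lebesgue_rV_invariance.

(** * Rotation invariance of Lebesgue measure, through the Gaussian density *)

Section lebesgue_rV_orthogonal.
Context {R : realType}.

Definition gauss_density n (x : 'rV[R]_n) : R := \prod_(i < n) normal_pdf 0 1 (x 0 i).

Lemma gauss_density_ge0 n (x : 'rV[R]_n) : 0 <= gauss_density x.
Proof. by apply: prodr_ge0 => i _; exact: normal_pdf_ge0. Qed.

Lemma measurable_gauss_density n : measurable_fun setT (@gauss_density n).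
Proof.
apply: measurable_prod => i _.
by apply: measurableT_comp; [exact: measurable_normal_pdf|exact: measurable_coord].
Qed.

Lemma ge0_integral_rV_prod n (g : 'I_n -> R -> R) :
  (forall i, measurable_fun setT (g i)) -> (forall i x, 0 <= g i x) ->
  (\int[lebesgue_rV n]_x (\prod_(i < n) g i (x 0%R i))%:E =
   \prod_(i < n) \int[lebesgue_measure]_h (g i h)%:E)%E.
Proof.
elim: n g => [|n IHn] g mg g0.
  rewrite big_ord0 (eq_integral (cst 1%E)); last by move=> x _; rewrite big_ord0.
  by rewrite integral_cst// mul1e /= diracT.
have mp m (k : 'I_m -> R -> R) : (forall i, measurable_fun setT (k i)) ->
    measurable_fun setT (fun x : 'rV[R]_m => (\prod_(i < m) k i (x 0 i))%:E).
  move=> mk; apply/measurable_EFinP; apply: measurable_prod => i _.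
  by apply: measurableT_comp; [exact: mk|exact: measurable_coord].
rewrite ge0_integral_rV_cons; last 2 first.
- by apply: (mp n.+1 g).
- by move=> x; rewrite lee_fin prodr_ge0.
rewrite big_ord_recl -IHn//.
rewrite -ge0_integralZl//; last 3 first.
- by apply: (mp n (fun i => g (lift ord0 i))).
- by move=> x _; rewrite lee_fin prodr_ge0.
- by apply: integral_ge0 => h _; rewrite lee_fin.
apply: eq_integral => u _.
rewrite -ge0_integralZr//; last 3 first.
- by apply/measurable_EFinP; exact: (mg ord0).
- by move=> h _; rewrite lee_fin.
- by rewrite lee_fin prodr_ge0.
apply: eq_integral => h _.
rewrite big_ord_recl rV_cons0 EFinM; congr (_ * _)%E; congr EFin.
by apply: eq_bigr => i _; rewrite rV_consS.
Qed.

Lemma gauss_density_box n (A : 'I_n -> set R) : (forall i, measurable (A i)) ->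
  (\int[lebesgue_rV n]_(x in [set x : 'rV[R]_n | forall i, A i (x 0%R i)])
     (gauss_density x)%:E = \prod_(i < n) normal_prob 0 1 (A i))%E.
Proof.
move=> mA; rewrite integral_mkcond.
pose g i := normal_pdf 0 1 \_ (A i) : R -> R.
transitivity (\int[lebesgue_rV n]_x (\prod_(i < n) g i (x 0%R i))%:E)%E.
  apply: eq_integral => x _; rewrite patchE; case: ifPn => [|/negP xA].
    rewrite inE => xA; congr EFin; apply: eq_bigr => i _.
    by rewrite /g patchE mem_set//; exact: xA.
  have [i iA] : exists i, ~ A i (x 0 i).
    by apply/existsNP => xA'; apply: xA; rewrite inE.
  by rewrite (bigD1 i)//= /g patchE memNset// mul0r.
rewrite ge0_integral_rV_prod.
- apply: eq_bigr => i _; rewrite /normal_prob [RHS]integral_mkcond.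
  by apply: eq_integral => x _; rewrite /g !patchE; case: ifP.
- move=> i; apply/(measurable_restrictT _ (mA i)).
  by apply: measurable_funTS; exact: measurable_normal_pdf.
- by move=> i x; rewrite /g patchE; case: ifP => // _; exact: normal_pdf_ge0.
Qed.

Lemma integral_gauss_density n : (\int[lebesgue_rV n]_x (gauss_density x)%:E = 1)%E.
Proof.
have := @gauss_density_box n (fun=> setT) (fun=> measurableT).
rewrite big1 => [<-|i _]; last by rewrite probability_setT.
by congr integral; apply/seteqP; split.
Qed.

(** A product of exponentials of squares is the exponential of the sum of squares. Thus the density
    is constant on spheres, the origin of every rotation invariance below. *)
Lemma gauss_density_enorm n (x : 'rV[R]_n) :
  gauss_density x = normal_peak 1 ^+ n * expR (- (enorm x ^+ 2) / 2).
Proof.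
rewrite /enorm sqr_sqrtr; last by apply: sumr_ge0 => i _; exact: sqr_ge0.
rewrite -sumrN mulr_suml expR_sum -[n in X in X * _]card_ord -prodr_const -big_split/=.
apply: eq_bigr => i _; rewrite normal_pdfE ?oner_neq0// /normal_fun.
by rewrite subr0 expr1n.
Qed.

Lemma enorm_sqr n (x : 'rV[R]_n) : enorm x ^+ 2 = (x *m x^T) 0 0.
Proof.
rewrite sqr_sqrtr; last by apply: sumr_ge0 => i _; exact: sqr_ge0.
by rewrite mxE; apply: eq_bigr => i _; rewrite mxE expr2.
Qed.

Lemma enorm_orth n (Q : 'M[R]_n) (x : 'rV[R]_n) : Q *m Q^T = 1%:M ->
  enorm (x *m Q) = enorm x.
Proof.
move=> QQ; have : enorm (x *m Q) ^+ 2 = enorm x ^+ 2.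
  by rewrite !enorm_sqr trmx_mul mulmxA -(mulmxA x) QQ mulmx1.
by move/eqP; rewrite eqrXn2 ?sqrtr_ge0// => /eqP.
Qed.

Lemma measurable_mulmxr n m (Q : 'M[R]_(n, m)) :
  measurable_fun setT (fun x : 'rV[R]_n => x *m Q).
Proof.
apply/measurable_fun_rVP => i; under eq_fun do rewrite mxE.
apply: measurable_sum => j.
by apply: measurable_funM => //; exact: measurable_coord.
Qed.

Lemma measurable_rVD d (T : measurableType d) n (f g : T -> 'rV[R]_n) :
  measurable_fun setT f -> measurable_fun setT g ->
  measurable_fun setT (fun x => f x + g x).
Proof.
move=> /measurable_fun_rVP mf /measurable_fun_rVP mg.
apply/measurable_fun_rVP => i; under eq_fun do rewrite mxE.
exact: measurable_funD.
Qed.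

Lemma measurable_rVZ d (T : measurableType d) n (a : R) (f : T -> 'rV[R]_n) :
  measurable_fun setT f -> measurable_fun setT (fun x => a *: f x).
Proof.
move=> /measurable_fun_rVP mf.
apply/measurable_fun_rVP => i; under eq_fun do rewrite mxE.
exact: measurable_funM.
Qed.

Lemma measurable_rVB d (T : measurableType d) n (f g : T -> 'rV[R]_n) :
  measurable_fun setT f -> measurable_fun setT g ->
  measurable_fun setT (fun x => f x - g x).
Proof.
move=> mf mg; under eq_fun do rewrite -scaleN1r.
by apply: measurable_rVD => //; exact: measurable_rVZ.
Qed.

Local Open Scope ereal_scope.

(* Insert the rotation invariant density b through [\int b (x Q + y) dy = 1],
   exchange the integrals and translate [x] by [- y Q^-1]. *)
Lemma ge0_integral_rV_orth n (Q : 'M[R]_n) (f : 'rV[R]_n -> \bar R) :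
  Q *m Q^T = 1%:M -> measurable_fun setT f -> (forall x, 0 <= f x) ->
  \int[lebesgue_rV n]_x f (x *m Q) = \int[lebesgue_rV n]_x f x.
Proof.
move=> QQ mf f0.
have QTQ : Q^T *m Q = 1%:M by exact: mulmx1C.
pose b (x : 'rV[R]_n) := (gauss_density x)%:E.
have mb : measurable_fun setT b.
  by apply/measurable_EFinP; exact: measurable_gauss_density.
have b0 x : 0 <= b x by rewrite lee_fin gauss_density_ge0.
have bQ x : b (x *m Q) = b x by rewrite /b !gauss_density_enorm enorm_orth.
have mfQ : measurable_fun setT (fun x : 'rV[R]_n => f (x *m Q)).
  by apply: measurableT_comp => //; exact: measurable_mulmxr.
transitivity (\int[lebesgue_rV n]_x \int[lebesgue_rV n]_y
    (f (x *m Q) * b (x *m Q + y)%R)).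
  apply: eq_integral => x _.
  rewrite ge0_integralZl//; last first.
    by apply: measurableT_comp => //; exact: measurable_rVD.
  under eq_integral do rewrite addrC -[X in (X + _)%R]scale1r.
  rewrite (ge0_integral_rV_affine _ (or_introl erefl))//.
  by rewrite integral_gauss_density mule1.
rewrite (fubini_tonelli (fun p : 'rV[R]_n * 'rV[R]_n => f (p.1 *m Q) * b (p.1 *m Q + p.2)%R))/=; last 2 first.
- have mQ1 : measurable_fun setT (fun p : 'rV[R]_n * 'rV[R]_n => p.1 *m Q).
    by apply: (measurableT_comp (measurable_mulmxr Q)); exact: measurable_fst.
  apply: emeasurable_funM; apply: measurableT_comp => //.
  by apply: measurable_rVD => //; exact: measurable_snd.
- by move=> p; exact: mule_ge0.
transitivity (\int[lebesgue_rV n]_y \int[lebesgue_rV n]_x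
    (f (x *m Q - y)%R * b x)).
  apply: eq_integral => y _.
  pose g (x : 'rV[R]_n) := f (x *m Q) * b (x *m Q + y)%R.
  rewrite -[LHS](ge0_integral_rV_affine (- (y *m Q^T))%R (or_introl erefl) (f := g)); last 2 first.
  - apply: emeasurable_funM => //; apply: measurableT_comp => //.
    by apply: measurable_rVD => //; exact: measurable_mulmxr.
  - by move=> x; exact: mule_ge0.
  apply: eq_integral => x _; rewrite /g scale1r mulmxBl -mulmxA QTQ mulmx1.
  by rewrite subrK bQ.
rewrite -(fubini_tonelli (fun p : 'rV[R]_n * 'rV[R]_n => f (p.1 *m Q - p.2)%R * b p.1))/=; last 2 first.
- have mQ1 : measurable_fun setT (fun p : 'rV[R]_n * 'rV[R]_n => p.1 *m Q).
    by apply: (measurableT_comp (measurable_mulmxr Q)); exact: measurable_fst.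
  apply: emeasurable_funM; apply: measurableT_comp => //.
  by apply: measurable_rVB => //; exact: measurable_snd.
- by move=> p; exact: mule_ge0.
transitivity (\int[lebesgue_rV n]_x (b x * \int[lebesgue_rV n]_y f y)).
  apply: eq_integral => x _.
  under eq_integral do rewrite muleC.
  have mfx : measurable_fun setT (fun y : 'rV[R]_n => f (x *m Q - y)%R).
    by apply: measurableT_comp => //; exact: measurable_rVB.
  rewrite ge0_integralZl//; congr (_ * _).
  under eq_integral do rewrite addrC -scaleN1r.
  by rewrite (ge0_integral_rV_affine _ (or_intror erefl)).
rewrite ge0_integralZr//; last exact: integral_ge0.
by rewrite integral_gauss_density mul1e.
Qed.

End lebesgue_rV_orthogonal.

(** * Laws and densities *)

Section integral_law.
Local Open Scope ereal_scope.
Context {R : realType} d d' (T : measurableType d) (T' : measurableType d').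
Variables (m : {measure set T -> \bar R}) (nu : {measure set T' -> \bar R}).
Variables (Y : T -> T').
Hypotheses (mY : measurable_fun setT Y)
  (lawY : forall A, measurable A -> m (Y @^-1` A) = nu A).

Lemma ge0_integral_law (f : T' -> \bar R) :
  measurable_fun setT f -> (forall y, 0 <= f y) ->
  \int[m]_x f (Y x) = \int[nu]_y f y.
Proof.
move=> mf f0.
transitivity (\int[pushforward m Y]_y f y).
  by rewrite (ge0_integral_pushforward mY _ measurableT).
by apply: eq_measure_integral => A mA _; exact: lawY.
Qed.

(** The integral is by definition the difference of the integrals of the positive and negative
    parts, and each part transfers; hence [f] may have any sign. *)
Lemma integral_law (f : T' -> \bar R) :
  measurable_fun setT f -> \int[m]_x f (Y x) = \int[nu]_y f y.
Proof.
move=> mf; rewrite integralE [RHS]integralE.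
have -> : (fun x => f (Y x))^\+ = f^\+ \o Y by apply/funext => x; rewrite -funepos_comp.
have -> : (fun x => f (Y x))^\- = f^\- \o Y by apply/funext => x; rewrite -funeneg_comp.
congr (_ - _).
  by apply: ge0_integral_law => //; exact: measurable_funepos.
by apply: ge0_integral_law => //; exact: measurable_funeneg.
Qed.

End integral_law.

Section integral_density.
Local Open Scope ereal_scope.
Context {R : realType} d (T : measurableType d).
Variables (m nu : {measure set T -> \bar R}) (g : T -> R).
Hypotheses (mg : measurable_fun setT g) (g0 : forall x, (0 <= g x)%R)
  (nuE : forall A, measurable A -> nu A = \int[m]_(x in A) (g x)%:E).
Import HBNNSimple.

Let mg' : measurable_fun setT (EFin \o g).
Proof. exact/measurable_EFinP. Qed.

(** For simple functions both sides are finite sums given by the density formula; monotone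
    convergence along [nnsfun_approx] does the rest. *)
Lemma ge0_integral_density (f : T -> \bar R) :
  measurable_fun setT f -> (forall x, 0 <= f x) ->
  \int[nu]_x f x = \int[m]_x (f x * (g x)%:E).
Proof.
move=> mf f0.
pose f_ := nnsfun_approx measurableT mf.
have f_cvg x : (EFin \o f_^~ x) @ \oo --> f x.
  by apply: cvg_nnsfun_approx => // *; exact: f0.
transitivity (limn (fun n => \int[nu]_x (f_ n x)%:E)).
  rewrite -monotone_convergence//.
  - by apply: eq_integral => x _; apply/esym/cvg_lim => //; exact: f_cvg.
  - by move=> n; exact/measurable_EFinP.
  - by move=> n x _; rewrite lee_fin.
  - by move=> x _ i j ij; rewrite lee_fin; exact/lefP/nd_nnsfun_approx.
rewrite [X in limn X](_ : _ = (fun n => \int[m]_x ((f_ n x)%:E * (g x)%:E))).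
  rewrite -monotone_convergence//.
  - apply: eq_integral => x _; apply/cvg_lim => //.
    by apply: cvgeZr => //; exact: f_cvg.
  - by move=> n; apply: emeasurable_funM => //; exact/measurable_EFinP.
  - by move=> n x _; rewrite mule_ge0// lee_fin.
  - by move=> x _ i j ij; rewrite lee_wpmul2r ?lee_fin//; exact/lefP/nd_nnsfun_approx.
apply/funext => n.
transitivity (\sum_(r \in range (f_ n)) r%:E * nu (f_ n @^-1` [set r])).
  under eq_integral do rewrite fimfunE -fsumEFin//.
  rewrite ge0_integral_fsum//; last 2 first.
  - by move=> r; exact/measurable_EFinP/measurable_funM.
  - by move=> r x _; rewrite nnfun_muleindic_ge0.
  by apply: eq_fsbigr => r _; rewrite integralZl_indic_nnsfun// integral_indic// setIT.
transitivity (\sum_(r \in range (f_ n))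
    \int[m]_x ((r * \1_(f_ n @^-1` [set r]) x)%:E * (g x)%:E)).
  apply: eq_fsbigr => r _.
  (* The formula for sets is multiplied by [r], which must be nonnegative to enter the integral; a
     negative [r] has an empty preimage. *)
  have [r0|r0] := ltP r 0%R.
    rewrite preimage_nnfun0// measure0 mule0 integral0_eq// => x _.
    by rewrite indic0 mulr0 mul0e.
  rewrite nuE// integral_mkcond epatch_indic -ge0_integralZl_EFin//; last 2 first.
  - by move=> x _; rewrite mule_ge0// lee_fin.
  - apply: emeasurable_funM; first exact: mg'.
    by apply/measurable_EFinP; exact: measurable_indic.
  by apply: eq_integral => x _ /=; rewrite EFinM -muleA; congr (_ * _); rewrite muleC.
rewrite -ge0_integral_fsum//; last 2 first.
- by move=> r; apply: emeasurable_funM => //; exact/measurable_EFinP/measurable_funM.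
- by move=> r x _; apply: mule_ge0; [rewrite EFinM nnfun_muleindic_ge0|rewrite lee_fin].
apply: eq_integral => x _; rewrite -ge0_mule_fsuml; last first.
  by move=> r; rewrite EFinM nnfun_muleindic_ge0.
by rewrite [in RHS]fimfunE -fsumEFin.
Qed.

End integral_density.

(** * Moments of the normal law *)

Section normal_moments.
Context {R : realType}.
Notation mu := (@lebesgue_measure R).
Local Open Scope ereal_scope.

Lemma mem_set_itvcy (a x : R) : (x \in `[a, +oo[%classic) = (a <= x)%R.
Proof. by apply/idP/idP; rewrite inE/= in_itv/= andbT. Qed.

Lemma ge0_integral_normal_prob (m s : R) (f : R -> \bar R) :
  measurable_fun setT f -> (forall x, 0 <= f x) ->
  \int[normal_prob m s]_x f x = \int[mu]_x (f x * (normal_pdf m s x)%:E).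
Proof.
by move=> mf f0; apply: ge0_integral_density => //;
  [exact: measurable_normal_pdf|move=> x; exact: normal_pdf_ge0].
Qed.

(** The map is the reflection about the mean, which preserves both Lebesgue measure and the
    density. *)
Lemma normal_prob_sym (m s : R) A : s != 0%R -> measurable A ->
  normal_prob m s ((fun x => -1 * x + 2 * m)%R @^-1` A) = normal_prob m s A.
Proof.
move=> s0 mA; rewrite /normal_prob integral_mkcond [RHS]integral_mkcond.
rewrite -[RHS](@ge0_integral_affine _ (-1)%R (2 * m)%R); [|by right| |].
- apply: eq_integral => x _; rewrite !patchE.
  have -> : (x \in (fun x => -1 * x + 2 * m)%R @^-1` A) = ((-1 * x + 2 * m)%R \in A).
    by apply/idP/idP; rewrite !inE.
  case: ifP => // _; congr EFin.
  rewrite !normal_pdfE// /normal_fun.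
  by have -> : ((-1 * x + 2 * m - m) ^+ 2 = (x - m) ^+ 2)%R by ring.
- apply/(measurable_restrictT _ mA)/measurable_funTS/measurable_EFinP.
  exact: measurable_normal_pdf.
- by move=> x; rewrite patchE; case: ifP => // _; rewrite lee_fin normal_pdf_ge0.
Qed.

(** By symmetry [x] and [2 m - x] have the same integral, so the mean equals [2 m] minus itself. *)
Lemma normal_prob_mean0 (m s : R) : s != 0%R ->
  \int[normal_prob m s]_x x%:E = 0 -> m = 0%R.
Proof.
move=> s0 I0.
have mE : measurable_fun [set: R] (@EFin R) by exact: EFin_measurable.
have intE : (normal_prob m s).-integrable setT (@EFin R).
  apply/integrableP; split => //.
  (* A finite integral forces integrability: the difference of the two parts is infinite as soon as
     one part is, even when both are. *)
  have [h _] := @abse_integralP _ (measurableTypeR R) R (normal_prob m s) setT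
    (@EFin R) measurableT mE.
  by apply: h; rewrite I0 abse0.
have : \int[normal_prob m s]_x ((-1 * x + 2 * m)%R)%:E = 0.
  rewrite -I0; apply: (@integral_law _ _ _ _ _ (normal_prob m s) (normal_prob m s)
    (fun x => -1 * x + 2 * m)%R _ _ EFin) => //.
    by apply: measurable_funD => //; exact: measurable_funM.
  by move=> A mA; exact: normal_prob_sym.
under eq_integral do rewrite EFinD EFinM.
rewrite integralD//; last 2 first.
- exact: integrableZl.
- by apply: finite_measure_integrable_cst.
rewrite integralZl// I0 mule0 add0e integral_cst//= probability_setT mule1.
move=> -[] /eqP; rewrite mulf_eq0 pnatr_eq0/= => /eqP; exact.
Qed.

(** The derivative of the density [p] is [- x p / s ^ 2], so [- s ^ 2 p] is an antiderivative of
    [x p]; it vanishes at infinity. *)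
Lemma integral_x_normal_pdf (s y : R) : s != 0%R -> (0 <= y)%R ->
  \int[mu]_(x in `[y, +oo[) (x * normal_pdf 0 s x)%:E = (s ^+ 2 * normal_pdf 0 s y)%:E.
Proof.
move=> s0 y0.
pose F (x : R) := (- s ^+ 2 * normal_pdf 0 s x)%R.
have eN (a b : R) : (- a / b = - b^-1 * a)%R by rewrite !mulNr mulrC.
have FE : F = ((- s ^+ 2 * normal_peak s) *:
    (@expR R \o (- (s ^+ 2 *+ 2)^-1 *: (@id R ^+ 2))))%R.
  apply/funext => x; rewrite /F normal_pdfE// /normal_fun !fctE/= subr0.
  by rewrite /GRing.scale/= mulrA eN.
have dF (x : R) : is_derive x 1%R F (x * normal_pdf 0 s x)%R.
  rewrite FE; apply: is_derive_eq.
  rewrite normal_pdfE// /normal_fun !fctE/= subr0 /GRing.scale/=.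
  rewrite eN; field.
  by rewrite s0.
rewrite (@ge0_continuous_FTC2y _ _ F y 0%R).
- by rewrite sub0e -EFinN /F mulNr opprK.
- by move=> x yx; rewrite mulr_ge0 ?normal_pdf_ge0// (le_trans y0).
- apply: continuous_subspaceT => x; apply: continuousM => //.
  exact: continuous_normal_pdf.
- rewrite FE -(mulr0 (- s ^+ 2 * normal_peak s)%R); apply: cvgZr.
  have -> : (expR \o (- (s ^+ 2 *+ 2)^-1 *: (@id R ^+ 2)))%R =
      (fun x => expR (- x)) \o (fun x : R => x ^+ 2 * (s ^+ 2 *+ 2)^-1)%R.
    by apply/funext => x; rewrite /= !fctE /GRing.scale/= mulNr mulrC.
  apply: (cvg_comp _ (fun x => expR (- x))); last exact: cvgr_expR.
  apply: gt0_cvgMly; last exact: cvgr_expr2.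
  by rewrite invr_gt0 pmulrn_lgt0// exprn_even_gt0.
- by move=> x _; apply: ex_derive.
- apply: cvg_at_right_filter; apply: differentiable_continuous.
  by apply/derivable1_diffP; exact: ex_derive.
- by move=> x _; rewrite derive1E; apply: derive_val.
Qed.

(** This is the tail integral from 0 with [s = 1]: the constant of the theorem is the standard
    normal density at 0. *)
Lemma integral_normal_prob_pos :
  \int[normal_prob 0 1]_x (Num.max x 0)%:E = ((Num.sqrt (2 * pi))^-1)%:E :> \bar R.
Proof.
rewrite ge0_integral_normal_prob//; last 2 first.
- apply/measurable_EFinP; exact: measurable_maxr.
- by move=> x; rewrite lee_fin le_max lexx orbT.
have := @integral_x_normal_pdf 1 0 (oner_neq0 _) (lexx _).
rewrite expr1n mul1r.
have -> : normal_pdf 0 1 0 = ((Num.sqrt (2 * pi))^-1)%R :> R.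
  rewrite normal_pdfE ?oner_neq0// /normal_fun subrr expr0n/= oppr0 mul0r expR0 mulr1.
  by rewrite /normal_peak expr1n mul1r mulr_natl.
move=> <-; rewrite [RHS]integral_mkcond; apply: eq_integral => x _.
rewrite patchE mem_set_itvcy; case: leP => x0 //.
by rewrite mul0e.
Qed.

(** On the half-line, [x ^ 2] is the integral of [x] over [0 <= y <= x]. After exchanging the
    integrals the inner one is the tail integral [s ^ 2 p(y)], which leaves [s ^ 2] times the mass
    of [p]. *)
Lemma integral_normal_prob_sqr (s : R) : s != 0%R ->
  \int[normal_prob 0 s]_x (x ^+ 2)%:E = (s ^+ 2)%:E.
Proof.
move=> s0; pose p := normal_pdf 0 s.
have mp : measurable_fun setT p by exact: measurable_normal_pdf.
have p0 x : (0 <= p x)%R by exact: normal_pdf_ge0.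
rewrite ge0_integral_normal_prob//; last 2 first.
- by apply/measurable_EFinP; exact: exprn_measurable.
- by move=> x; rewrite lee_fin sqr_ge0.
have halves (f : R -> R) : measurable_fun setT f -> (forall x, 0 <= f x)%R ->
    (forall x, f (- x) = f x)%R ->
    \int[mu]_x (f x)%:E = \int[mu]_(x in `[0%R, +oo[) (f x)%:E + \int[mu]_(x in `[0%R, +oo[) (f x)%:E.
  move=> mf f0 fN.
  rewrite (_ : [set: R] = `]-oo, 0%R] `|` `]0%R, +oo[)%classic; last first.
    by apply/seteqP; split => // x _ /=; rewrite !in_itv/= andbT; case: (leP x 0%R); [left|right].
  rewrite ge0_integral_setU//=.
  - congr (_ + _).
      rewrite ge0_integration_by_substitution0//; last exact/measurable_EFinP.
      by apply: eq_integral => x _; rewrite fN.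
    rewrite integral_itv_obnd_cbnd//.
    by apply/measurable_EFinP/measurable_funTS.
  - by apply/measurable_EFinP/measurable_funTS.
  - by move=> x _; rewrite lee_fin.
  - by apply/disj_setPS => x /=; rewrite !in_itv/= andbT => -[/le_lt_trans h /h]; rewrite ltxx.
have pN (x : R) : p (- x)%R = p x.
  by rewrite /p !normal_pdfE// /normal_fun !subr0 sqrrN.
have mx2p : measurable_fun setT (fun x : R => x ^+ 2 * p x)%R.
  by apply: measurable_funM => //; exact: exprn_measurable.
under eq_integral do rewrite -EFinM.
rewrite (halves (fun x : R => x ^+ 2 * p x)%R)//; last 2 first.
- by move=> x /=; rewrite mulr_ge0 ?sqr_ge0.
- by move=> x /=; rewrite pN sqrrN.
have -> : \int[mu]_(x in `[0%R, +oo[) (x ^+ 2 * p x)%:E =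
    (s ^+ 2)%:E * \int[mu]_(x in `[0%R, +oo[) (p x)%:E.
  pose S : set (measurableTypeR R * measurableTypeR R) := [set q | (0 <= q.2 <= q.1)%R].
  have mS : measurable S.
    rewrite (_ : S = snd @^-1` `[0%R, +oo[ `&` (fun q => q.1 - q.2)%R @^-1` `[0%R, +oo[).
      apply: measurableI.
        by rewrite -[X in measurable X]setTI; exact: measurable_snd.
      have m12 : measurable_fun setT
          (fun q : measurableTypeR R * measurableTypeR R => q.1 - q.2)%R.
        by apply: measurable_funB; [exact: measurable_fst|exact: measurable_snd].
      by rewrite -[X in measurable X]setTI; exact: m12.
    apply/seteqP; split => q /=; rewrite !in_itv/= !andbT subr_ge0.
      by move=> /andP.
    by move=> [? ?]; apply/andP.
  (* The absolute value makes the integrand nonnegative on the whole plane, for Tonelli; it changes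
     nothing on [S], where the first coordinate is nonnegative. *)
  pose k (q : measurableTypeR R * measurableTypeR R) := (\1_S q * `|q.1 * p q.1|)%R%:E.
  have mk : measurable_fun setT k.
    apply/measurable_EFinP/measurable_funM; first exact: measurable_indic.
    apply: measurableT_comp => //; apply: measurable_funM; first exact: measurable_fst.
    by apply: measurableT_comp => //; exact: measurable_fst.
  have k0 q : 0 <= k q by rewrite lee_fin mulr_ge0.
  transitivity (\int[mu]_x \int[mu]_y k (x, y)).
    rewrite integral_mkcond; apply: eq_integral => x _; rewrite patchE.
    have kE y : k (x, y) = `|x * p x|%:E * (\1_(`[0%R, x]%classic) y)%:E.
      have kS : (y \in `[0%R, x]%classic) = ((x, y) \in S).
        by apply/idP/idP; rewrite !inE /S/= ?in_itv.
      by rewrite /k/= -EFinM mulrC !indicE kS.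
    under eq_integral do rewrite kE.
    rewrite ge0_integralZl//; last by apply/measurable_EFinP; exact: measurable_indic.
    rewrite integral_indic// setIT /= lebesgue_measure_itv/= lte_fin.
    rewrite mem_set_itvcy; case: (leP 0%R x) => x0.
      rewrite ger0_norm ?mulr_ge0//; have [x1|x1] := ltP 0%R x.
        by rewrite oppr0 adde0 -EFinM; congr EFin; ring.
      by have -> : x = 0%R by [apply/le_anti/andP]; rewrite expr0n !mul0r mule0.
    by rewrite ltNge (ltW x0) mule0.
  rewrite (fubini_tonelli k)//.
  rewrite -ge0_integralZl//; last 3 first.
  - by apply/measurable_EFinP/measurable_funTS.
  - by move=> x _; rewrite lee_fin.
  - by rewrite lee_fin sqr_ge0.
  rewrite [RHS]integral_mkcond; apply: eq_integral => y _; rewrite patchE.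
  rewrite mem_set_itvcy; case: (leP 0%R y) => y0.
    rewrite -EFinM -integral_x_normal_pdf// [RHS]integral_mkcond.
    apply: eq_integral => x _; rewrite patchE /k/= indicE.
    have -> : ((x, y) \in S) = (y <= x)%R.
      by apply/idP/idP; rewrite inE /S/= y0.
    rewrite mem_set_itvcy; case: leP => yx; last by rewrite mul0r.
    by rewrite mul1r ger0_norm// mulr_ge0// (le_trans y0).
  apply: integral0_eq => x _; rewrite /k/= indicE memNset ?mul0r//.
  by rewrite /S/= leNgt y0.
rewrite -ge0_muleDr; last 2 first.
- by apply: integral_ge0 => x _; rewrite lee_fin.
- by apply: integral_ge0 => x _; rewrite lee_fin.
by rewrite -halves// integral_normal_pdf mule1.
Qed.

End normal_moments.

(** * The standard normal vector *)

Section rV_law.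
Context {R : realType}.

(** Boxes are stable under intersection and generate the sigma-algebra, and the total mass is
    finite, so the uniqueness theorem for measures applies. *)
Lemma rV_box_unique n (m1 m2 : {measure set 'rV[R]_n -> \bar R}) :
  (m1 setT < +oo)%E ->
  (forall A : 'I_n -> set R, (forall i, measurable (A i)) ->
    m1 [set x | forall i, A i (x 0 i)] = m2 [set x | forall i, A i (x 0 i)]) ->
  forall E, measurable E -> m1 E = m2 E.
Proof.
move=> m1oo m12 E mE.
pose G := [set B | exists A : 'I_n -> set R, (forall i, measurable (A i)) /\
  B = [set x : 'rV[R]_n | forall i, A i (x 0 i)]].
have GT : G setT.
  by exists (fun=> setT); split => //; apply/seteqP; split.
have Gm : G `<=` measurable.
  move=> _ [A [mA ->]].
  rewrite (_ : [set _ | _] = \bigcap_(i in [set: 'I_n])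
     [set x : 'rV[R]_n | A i (x 0 i)]); last first.
    by apply/seteqP; split => x Ax i; [move=> _; exact: Ax|exact: (Ax i I)].
  apply: fin_bigcap_measurable => // i _.
  by rewrite -[X in measurable X]setTI; exact: measurable_coord.
apply: (g_sigma_algebra_measure_unique G Gm (fun=> setT)) => //.
- by rewrite bigcup_const.
- move=> _ _ [A [mA ->]] [B [mB ->]]; exists (fun i => A i `&` B i); split.
    by move=> i; exact: measurableI.
  apply/seteqP; split => x; first by move=> [Ax Bx] i; split.
  by move=> ABx; split => i; have [] := ABx i.
- by move=> _ [A [mA ->]]; exact: m12.
(* A condition on one coordinate is a box whose other sides are the whole line, so every coordinate
   is measurable for the boxes. *)
have mid : measurable_fun [set: g_sigma_algebraType G] (fun x => x : 'rV[R]_n).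
  apply/measurable_fun_rVP => i _ B mB; rewrite setTI.
  apply: sub_sigma_algebra; exists (fun j => if j == i then B else setT); split.
    by move=> j; case: ifP.
  apply/seteqP; split => x /=.
    by move=> Bx j; case: eqVneq => // ->.
  by move=> /(_ i); rewrite eqxx.
by have := mid measurableT E mE; rewrite setTI.
Qed.

Definition gauss_measure n (A : set 'rV[R]_n) : \bar R :=
  (\int[lebesgue_rV n]_(x in A) (gauss_density x)%:E)%E.

Section gauss_measure.
Variable n : nat.
Local Notation gauss_measure := (@gauss_measure n).

Let gauss0 : gauss_measure set0 = 0%E.
Proof. exact: integral_set0. Qed.

Let gauss_ge0 A : (0 <= gauss_measure A)%E.
Proof. by apply: integral_ge0 => x _; rewrite lee_fin gauss_density_ge0. Qed.

Let gauss_sigma_additive : semi_sigma_additive gauss_measure.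
Proof.
move=> F mF tF mUF; rewrite /gauss_measure ge0_integral_bigcup//; last 2 first.
- by apply/measurable_EFinP/measurable_funTS; exact: measurable_gauss_density.
- by move=> x _; rewrite lee_fin gauss_density_ge0.
apply: is_cvg_ereal_nneg_natsum_cond => k _ _; exact: gauss_ge0.
Qed.

HB.instance Definition _ := isMeasure.Build _ _ _ gauss_measure
  gauss0 gauss_ge0 gauss_sigma_additive.

End gauss_measure.

Lemma gauss_measure_orth n (Q : 'M[R]_n) (A : set 'rV[R]_n) :
  Q *m Q^T = 1%:M -> measurable A ->
  gauss_measure [set x | A (x *m Q)] = gauss_measure A.
Proof.
move=> QQ mA; rewrite /gauss_measure integral_mkcond [RHS]integral_mkcond.
rewrite -[RHS](ge0_integral_rV_orth QQ).
- apply: eq_integral => x _; rewrite !patchE.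
  have -> : (x \in [set x | A (x *m Q)]) = (x *m Q \in A).
    by apply/idP/idP; rewrite !inE.
  by case: ifP => // _; rewrite !gauss_density_enorm enorm_orth.
- apply/(measurable_restrictT _ mA)/measurable_funTS/measurable_EFinP.
  exact: measurable_gauss_density.
- by move=> x; rewrite patchE; case: ifP => // _; rewrite lee_fin gauss_density_ge0.
Qed.

(* The Householder reflection exchanging w and |w| e_0. *)
Lemma ex_orth_enorm n (w : 'rV[R]_n.+1) : exists H : 'M[R]_n.+1,
  H *m H^T = 1%:M /\ w = enorm w *: (delta_mx 0 0 *m H).
Proof.
set a := enorm w; set e : 'rV[R]_n.+1 := delta_mx 0 0.
pose v := w - a *: e.
have [v0|v0] := eqVneq v 0.
  exists 1%:M; rewrite trmx1 mulmx1; split => //.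
  by apply/eqP; rewrite mulmx1 -subr_eq0; apply/eqP.
pose c := (v *m v^T) 0 0.
have c0 : c != 0.
  rewrite /c -enorm_sqr sqrf_eq0; apply: contra v0 => /eqP v0.
  have : enorm v ^+ 2 = 0 by rewrite v0 expr0n.
  rewrite sqr_sqrtr; last by apply: sumr_ge0 => i _; exact: sqr_ge0.
  move=> /eqP; rewrite psumr_eq0; last by move=> i _; exact: sqr_ge0.
  move=> /allP vi; apply/eqP/rowP => i; rewrite [RHS]mxE.
  by have /= := vi i (mem_index_enum _); rewrite sqrf_eq0 => /eqP.
have ee : e *m e^T = 1%:M.
  by rewrite trmx_delta mul_delta_mx; apply/matrixP => i j; rewrite !mxE (ord1 i) (ord1 j).
have ev : (e *m v^T) = (w 0 0 - a)%:M.
  apply/matrixP => i j; rewrite !mxE (ord1 i) (ord1 j) eqxx mulr1n.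
  rewrite (bigD1 0)//= big1 ?addr0; last first.
    by move=> k k0; rewrite !mxE (negbTE k0) andbF mul0r.
  by rewrite !mxE eqxx mul1r/= mulr1.
have wv : w *m v^T = (a ^+ 2 - a * w 0 0)%:M.
  rewrite /v linearB/= linearZ/= mulmxBr -scalemxAr.
  have -> : w *m w^T = (a ^+ 2)%:M.
    by apply/matrixP => i j; rewrite (ord1 i) (ord1 j) -enorm_sqr !mxE mulr1n.
  have -> : w *m e^T = (w 0 0)%:M.
    apply/matrixP => i j; rewrite !mxE (ord1 i) (ord1 j) eqxx mulr1n.
    rewrite (bigD1 0)//= big1 ?addr0; last first.
      by move=> k k0; rewrite !mxE (negbTE k0) andbF mulr0.
    by rewrite !mxE eqxx mulr1.
  by rewrite scale_scalar_mx -raddfB.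
(* As [w] and [a *: e] have the same norm, the square of the norm of their difference has this form;
   it makes the reflection along [v] send [a *: e] to [w]. *)
have cE : c = 2 * a * (a - w 0 0).
  rewrite /c {1}/v mulmxBl wv -scalemxAl ev !mxE !mulr1n; ring.
have vv : v *m v^T = c%:M.
  by apply/matrixP => i j; rewrite (ord1 i) (ord1 j) /c !mxE mulr1n.
pose H : 'M[R]_n.+1 := 1%:M - (2 / c) *: (v^T *m v).
have HT : H^T = H.
  by rewrite /H linearB/= trmx1 linearZ/= trmx_mul trmxK.
exists H; split.
  set M := v^T *m v in H HT *.
  have MM : M *m M = c *: M.
    by rewrite /M mulmxA -(mulmxA v^T v v^T) vv mul_mx_scalar -scalemxAl.
  rewrite HT /H mulmxBl !mulmxBr !mul1mx !mulmx1 -scalemxAl -scalemxAr MM !scalerA.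
  have -> : 2 / c * (2 / c) * c = 2 / c + 2 / c by field.
  by rewrite scalerDl opprB addrK subrK.
rewrite /H mulmxBr mulmx1 -scalemxAr mulmxA ev mul_scalar_mx scalerBr !scalerA.
set k := (X in w = _ - X *: _).
have -> : k = - (c / c) by rewrite {1}cE /k; field.
rewrite divff//.
by rewrite scaleN1r opprK addrC subrK.
Qed.

Definition dotr n (w z : 'rV[R]_n) : R := \sum_i w 0 i * z 0 i.

Lemma dotrE n (w z : 'rV[R]_n) : dotr w z = (w *m z^T) 0 0.
Proof. by rewrite mxE; apply: eq_bigr => i _; rewrite mxE. Qed.

Lemma measurable_dotr n (w : 'rV[R]_n) : measurable_fun setT (dotr w).
Proof.
apply: measurable_sum => i.
by apply: measurable_funM => //; exact: measurable_coord.
Qed.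

Section standard_normal.
Context d (Omega : measurableType d) (P : probability Omega R) (n : nat).
Variables (Z : Omega -> 'rV[R]_n.+1).
Hypotheses (mZ : measurable_fun setT Z)
  (Zlaw : forall A : 'I_n.+1 -> set R, (forall i, measurable (A i)) ->
    P [set w | forall i, A i (Z w 0 i)] = (\prod_i normal_prob 0 1 (A i))%E).

Lemma std_normal_law A : measurable A -> P (Z @^-1` A) = gauss_measure A.
Proof.
move=> mA.
apply: (@rV_box_unique n.+1 (pushforward P Z) (@gauss_measure n.+1)) => //.
  by rewrite /= /pushforward preimage_setT probability_setT ltry.
move=> B mB; transitivity (\prod_i normal_prob 0 1 (B i))%E; first exact: Zlaw.
exact/esym/gauss_density_box.
Qed.

Lemma std_normal_coord0 A : measurable A ->
  P [set w | A (Z w 0 0)] = normal_prob 0 1 A.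
Proof.
move=> mA.
transitivity (P [set w | forall i, (if i == 0 then A else setT) (Z w 0 i)]).
  congr (P _); apply/seteqP; split => w /=; last by move=> /(_ 0); rewrite eqxx.
  by move=> Aw i; case: eqVneq => // ->.
rewrite (@Zlaw (fun i => if i == 0 then A else setT)); last by move=> i; case: ifP.
rewrite (bigD1 0)//= big1 ?mule1// => i /negbTE ->.
exact: probability_setT.
Qed.

(** For [w = |w| e_0 H] the scalar product is [|w|] times the first coordinate of [Z H^T], which has
    the law of [Z]; only one variable remains. *)
Lemma integral_std_normal_dot w :
  (\int[P]_x (Num.max (dotr w (Z x)) 0)%:E =
   (enorm w / Num.sqrt (2 * pi))%:E)%E.
Proof.
have [H [HH wH]] := ex_orth_enorm w.
have HTH : H^T *m (H^T)^T = 1%:M by rewrite trmxK; exact: mulmx1C.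
pose f (z : 'rV[R]_n.+1) := (Num.max (enorm w * z 0 0) 0)%:E.
have mf : measurable_fun setT f.
  apply/measurable_EFinP/measurable_maxr => //.
  by apply: measurable_funM => //; exact: measurable_coord.
have f0 z : (0 <= f z)%E by rewrite lee_fin le_max lexx orbT.
transitivity (\int[P]_x f (Z x *m H^T))%E.
  apply: eq_integral => x _; congr (Num.max _ 0)%:E.
  rewrite dotrE {1}wH -scalemxAl mxE; congr (_ * _).
  rewrite -mulmxA -[X in (_ *m X)]trmxK trmx_mul trmxK.
  rewrite -rowE mxE mxE.
  by [].
transitivity (\int[P]_x f (Z x))%E.
  rewrite [RHS](@ge0_integral_law _ _ _ _ _ _ (@gauss_measure n.+1) Z)//; last exact: std_normal_law.
  apply: (@ge0_integral_law _ _ _ _ _ P (@gauss_measure n.+1) (fun x => Z x *m H^T)) => //.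
    exact: (measurableT_comp (measurable_mulmxr H^T)).
  move=> A mA; transitivity (gauss_measure [set x | A (x *m H^T)]).
    apply: (@std_normal_law [set x | A (x *m H^T)]).
    by rewrite -[X in measurable X]setTI; exact: measurable_mulmxr.
  exact: gauss_measure_orth.
transitivity ((enorm w)%:E * \int[P]_x (Num.max (Z x 0%R 0%R) 0%R)%:E)%E.
  rewrite -ge0_integralZl//; last 3 first.
  - apply/measurable_EFinP/measurable_maxr => //.
    exact: (measurableT_comp (measurable_coord 0)).
  - by move=> x _; rewrite lee_fin le_max lexx orbT.
  - by rewrite lee_fin sqrtr_ge0.
  apply: eq_integral => x _; rewrite /f -EFinM maxr_pMr ?sqrtr_ge0// mulr0.
  by [].
rewrite EFinM; congr (_ * _)%E.
rewrite -integral_normal_prob_pos.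
apply: (@ge0_integral_law _ _ _ _ _ P (normal_prob 0 1) (fun x => Z x 0 0)
  _ _ (fun z => (Num.max z 0)%:E)).
- exact: (measurableT_comp (measurable_coord 0)).
- exact: std_normal_coord0.
- by apply/measurable_EFinP/measurable_maxr.
- by move=> x; rewrite lee_fin le_max lexx orbT.
Qed.

End standard_normal.

End rV_law.

(** * The law of the process at a fixed time *)

Section centered_gaussian.
Context {R : realType} d (Omega : measurableType d) (P : probability Omega R).

(** [gaussian_rv] puts no sign on [s], while the law depends on [s ^+ 2] alone. *)
Lemma normal_prob_abs (m s : R) : normal_prob m `|s| = normal_prob m s :> (set R -> \bar R).
Proof.
apply/funext => A; rewrite /normal_prob; apply: eq_integral => x _.
rewrite /normal_pdf normr_eq0; case: ifP => // _.
by rewrite /normal_fun /normal_peak real_normK// num_real.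
Qed.

(** Mean zero forces [m = 0], directly for a Dirac mass and by symmetry otherwise. A Dirac mass at 0
    contradicts the last hypothesis, so [s] is nonzero. *)
Lemma centered_gaussian_rv (V : Omega -> R) :
  gaussian_rv P V -> ('E_P[V] = 0)%E -> (0 < P [set w | V w != 0%R])%E ->
  exists s : R, [/\ 0 < s, (\int[P]_w (V w ^+ 2)%:E = (s ^+ 2)%:E)%E &
    forall A, measurable A -> P (V @^-1` A) = normal_prob 0 s A].
Proof.
move=> [mV [m [s lawV]]] EV0 Vnd.
have mE : measurable_fun [set: R] (@EFin R) by exact: EFin_measurable.
rewrite unlock in EV0.
have [s0|s0] := eqVneq s 0.
  have lawd A : measurable A -> P (V @^-1` A) = \d_m A.
    by move=> mA; rewrite lawV// /gaussian_law s0 eqxx.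
  have : (\int[\d_m]_x (x : R)%:E = 0)%E.
    by rewrite -EV0; apply/esym/(integral_law mV lawd).
  rewrite integral_dirac//= diracT mul1e => -[m0].
  have mN0 : measurable [set x : R | x != 0].
    rewrite (_ : [set _ | _] = ~` [set 0]); first exact: measurableC.
    by apply/seteqP; split=> x /= /eqP.
  move: Vnd; rewrite (lawd _ mN0) m0 diracE memNset ?ltxx//=.
  by rewrite eqxx.
have lawn A : measurable A -> P (V @^-1` A) = normal_prob m s A.
  by move=> mA; rewrite lawV// /gaussian_law (negbTE s0).
have m0 : m = 0.
  apply: (normal_prob_mean0 s0); rewrite -EV0.
  by apply/esym/(@integral_law _ _ _ _ _ P (normal_prob m s) V mV lawn).
exists `|s|; split; first by rewrite normr_gt0.
  rewrite real_normK ?num_real// -integral_normal_prob_sqr// -m0.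
  apply: (@ge0_integral_law _ _ _ _ _ P (normal_prob m s) V mV lawn (fun x => (x ^+ 2)%:E)).
    by apply/measurable_EFinP; exact: exprn_measurable.
  by move=> x; rewrite lee_fin sqr_ge0.
by move=> A mA; rewrite (lawn _ mA) m0 -(normal_prob_abs 0 s).
Qed.

End centered_gaussian.

Section gaussian_process_law.
Context {R : realType} (n : nat) d (Omega : measurableType d)
  (P : probability Omega R) (X : R -> Omega -> 'rV[R]_n.+1).
Hypotheses
    (X_meas : forall t : R, 0 <= t <= 1 -> measurable_fun setT (X t))
    (X_cadlag : forall w, cadlag (fun t => X t w))
    (X_start : P [set w | X 0 w = 0] = 1%E)
    (X_indep : independent_processes P (component X))
    (X_ident : identically_distributed P (component X))
    (X_gauss : forall i, gaussian_process P (component X i))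
    (X_mean : forall i, zero_mean P (component X i))
    (X_nondeg : forall t : R, 0 < t <= 1 ->
      (0 < P [set w | X t w <> 0%R])%E).

Let path_eval (t : R) (A : set R) : 0 <= t <= 1 -> measurable A ->
  path_measurable [set f : R -> R | A (f t)].
Proof. by move=> t01 mA; apply: sub_sigma_algebra; exists t, A. Qed.

(** If one coordinate vanished almost surely, so would all, being identically distributed, and with
    them [X t]. *)
Let coord_nondeg (t : R) i : 0 < t <= 1 -> (0 < P [set w | component X i t w != 0%R])%E.
Proof.
move=> t01; have t01' : 0 <= t <= 1 by move: t01 => /andP[/ltW -> ->].
have mN0 : measurable [set x : R | x != 0].
  rewrite (_ : [set _ | _] = ~` [set 0]); first exact: measurableC.
  by apply/seteqP; split=> x /= /eqP.
have mXj j : measurable [set w | component X j t w != 0].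
  rewrite -[X in measurable X]setTI.
  exact: (measurableT_comp (measurable_coord j) (X_meas t01') measurableT mN0).
rewrite lt0e measure_ge0 andbT; apply/eqP => P0.
have := X_nondeg t01; rewrite lt0e => /andP[/eqP + _]; apply.
(* [inord] turns the finite family of coordinates into a sequence, for countable subadditivity. *)
pose F k := [set w | component X (inord k) t w != 0].
have -> : [set w | X t w <> 0] = \bigcup_k F k.
  apply/seteqP; split => w /=.
    move=> Xw; apply: contra_notP Xw => Fw; apply/rowP => j; rewrite [RHS]mxE.
    apply: contra_notP Fw => /eqP wj; exists (val j) => //=.
    by rewrite /F/= inord_val.
  by move=> [k _]; rewrite /F/= /component => /eqP + X0; apply; rewrite X0 mxE.
apply: measure_negligible; first by apply: bigcup_measurable => k _; exact: mXj.
apply: negligible_bigcup => k; apply/negligibleP; first exact: mXj.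
rewrite -P0.
exact: (X_ident (inord k) i (@path_eval t _ t01' mN0)).
Qed.

(** [a * X t] is a linear combination with one term. The factor [a] is later 1, the inverse of the
    deviation at time 1, or a ratio of two deviations. *)
Let coord_law (t a : R) i : 0 < t <= 1 -> 0 < a -> exists s : R, [/\ 0 < s,
    (\int[P]_w ((a * X t w 0 i) ^+ 2)%:E = (s ^+ 2)%:E)%E &
    forall A, measurable A -> P [set w | A (a * X t w 0 i)] = normal_prob 0 s A].
Proof.
move=> t01 a0; have t01' : 0 <= t <= 1 by move: t01 => /andP[/ltW -> ->].
have mY : measurable_fun setT (fun w => X t w 0 i).
  exact: (measurableT_comp (measurable_coord i) (X_meas t01')).
apply: centered_gaussian_rv.
- have := X_gauss i (k := 1) (t := fun=> t) (fun=> a) (fun=> t01').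
  by under [X in gaussian_rv _ X]eq_fun do rewrite big_ord1.
- have EY0 := X_mean i t01'.
  rewrite unlock in EY0; rewrite unlock.
  have iY : P.-integrable setT (EFin \o (fun w => X t w 0 i)).
    have mEY : measurable_fun setT (EFin \o (fun w => X t w 0 i)).
      exact/measurable_EFinP.
    apply/integrableP; split => //.
    have [h _] := @abse_integralP _ _ R P setT _ measurableT mEY.
    by apply: h; rewrite EY0 abse0.
  under eq_integral do rewrite EFinM.
  by rewrite integralZl// EY0 mule0.
- rewrite [X in P X](_ : _ = [set w | component X i t w != 0]).
    exact: coord_nondeg.
  by apply/seteqP; split => w /=; rewrite mulf_eq0 (gt_eqF a0).
Qed.

Let coord_sqr (t : R) i : 0 <= t <= 1 ->
  (\int[P]_w (X t w 0%R i ^+ 2)%:E = \int[P]_w (X t w 0%R ord0 ^+ 2)%:E)%E.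
Proof.
move=> t01; have mY j : measurable_fun setT (fun w => X t w 0 j).
  exact: (measurableT_comp (measurable_coord j) (X_meas t01)).
have m2 : measurable_fun setT (fun x : R => (x ^+ 2)%:E).
  by apply/measurable_EFinP; exact: exprn_measurable.
have s2 (x : R) : (0 <= (x ^+ 2)%:E)%E by rewrite lee_fin sqr_ge0.
rewrite (@ge0_integral_law _ _ _ _ _ P (pushforward P (fun w => X t w 0 ord0))
  _ (mY i) _ _ m2 s2)//.
  by rewrite (@ge0_integral_law _ _ _ _ _ P (pushforward P (fun w => X t w 0 ord0))
    _ (mY ord0) _ _ m2 s2).
by move=> A mA; exact: (X_ident i ord0 (@path_eval t _ t01 mA)).
Qed.

Lemma variance_function_gt0 (t : R) : 0 < t <= 1 -> 0 < variance_function P X t.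
Proof.
move=> t01; have [s [s0 + _]] := coord_law ord0 t01 ltr01.
rewrite /variance_function unlock /component.
by under eq_integral do rewrite mul1r; move=> ->; rewrite /= exprn_gt0.
Qed.

Let sd t := Num.sqrt (variance_function P X t).

(** A centred normal law is identified by its second moment, and all coordinates share that of
    coordinate 0. *)
Lemma scaled_coord_law (t a : R) i : 0 < t <= 1 -> 0 < a ->
  forall A, measurable A -> P [set w | A (a * X t w 0 i)] = normal_prob 0 (a * sd t) A.
Proof.
move=> t01 a0; have t01' : 0 <= t <= 1 by move: t01 => /andP[/ltW -> ->].
have [s [s0 Es law]] := coord_law i t01 a0.
suff -> : a * sd t = s by [].
have mY : measurable_fun setT (fun w => X t w 0 i).
  exact: (measurableT_comp (measurable_coord i) (X_meas t01')).
have [s1 [s10 Es1 _]] := coord_law ord0 t01 ltr01.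
have s1E : sd t = s1.
  rewrite /sd /variance_function unlock /component.
  move: Es1; under eq_integral do rewrite mul1r.
  by move=> ->; rewrite /= sqrtr_sqr gtr0_norm.
have /eqP : s ^+ 2 = (a * sd t) ^+ 2.
  apply: EFin_inj; rewrite -Es s1E exprMn EFinM -Es1.
  under eq_integral do rewrite exprMn EFinM.
  rewrite ge0_integralZl//; last 3 first.
  - by apply/measurable_EFinP; exact: measurable_funX.
  - by move=> w _; rewrite lee_fin sqr_ge0.
  - by rewrite lee_fin sqr_ge0.
  rewrite coord_sqr//; congr (_ * _)%E.
  by apply: eq_integral => w _; rewrite mul1r.
by rewrite eqrXn2 ?(ltW s0) ?mulr_ge0 ?(ltW a0) ?sqrtr_ge0// => /eqP.
Qed.

Lemma scaled_law (t a : R) : 0 < t <= 1 -> 0 < a ->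
  forall A : 'I_n.+1 -> set R, (forall i, measurable (A i)) ->
  P [set w | forall i, A i ((a *: X t w) 0 i)] =
    (\prod_i normal_prob 0 (a * sd t) (A i))%E.
Proof.
move=> t01 a0 A mA; have t01' : 0 <= t <= 1 by move: t01 => /andP[/ltW -> ->].
pose F i := [set f : R -> R | A i (a * f t)].
have mF i : path_measurable (F i).
  apply: (@path_eval t [set x | A i (a * x)] t01').
  rewrite -[X in measurable X]setTI.
  by apply: (mulrl_measurable a).
rewrite [X in P X](_ : _ = [set w | forall i, F i (fun t => component X i t w)]); last first.
  by apply/seteqP; split => w /= wA i; have := wA i; rewrite /F/= /component mxE.
rewrite X_indep//; apply: eq_bigr => i _.
exact: scaled_coord_law.
Qed.

(** One standard normal vector on [Omega] serves all times: [X t] has the law of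
    [sd t *: normalized_end], for each [t] separately. *)
Definition normalized_end : Omega -> 'rV[R]_n.+1 :=
  fun w => (sd 1)^-1 *: X 1 w.

Lemma measurable_normalized_end : measurable_fun setT normalized_end.
Proof. by apply: measurable_rVZ; apply: X_meas; rewrite lexx ler01. Qed.

Lemma normalized_end_law (A : 'I_n.+1 -> set R) : (forall i, measurable (A i)) ->
  P [set w | forall i, A i (normalized_end w 0 i)] = (\prod_i normal_prob 0 1 (A i))%E.
Proof.
have sd1 : 0 < sd 1 by rewrite sqrtr_gt0 variance_function_gt0// ltr01 lexx.
have i01 : 0 < (1 : R) <= 1 by rewrite ltr01 lexx.
have i0 : 0 < (sd 1)^-1 by rewrite invr_gt0.
by move=> mA; rewrite (scaled_law i01 i0 mA) mulVf// gt_eqF.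
Qed.

Lemma process_law (t : R) : 0 < t <= 1 -> forall A, measurable A ->
  P (X t @^-1` A) = P [set w | A (sd t *: normalized_end w)].
Proof.
move=> t01; have t01' : 0 <= t <= 1 by move: t01 => /andP[/ltW -> ->].
have i01 : 0 < (1 : R) <= 1 by rewrite ltr01 lexx.
have mX : measurable_fun setT (X t) by exact: X_meas.
have sd_gt0 u : 0 < u <= 1 -> 0 < sd u.
  by move=> u01; rewrite sqrtr_gt0 variance_function_gt0.
have mZ : measurable_fun setT (fun w => sd t *: normalized_end w).
  by apply: measurable_rVZ; exact: measurable_normalized_end.
apply: (@rV_box_unique _ n.+1 (pushforward P (X t))
  (pushforward P (fun w => sd t *: normalized_end w))) => //.
  by rewrite /= /pushforward preimage_setT probability_setT ltry.
move=> A mA.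
transitivity (\prod_i normal_prob 0 (sd t) (A i))%E.
  rewrite -[sd t]mul1r -scaled_law//; congr (P _).
  by apply/seteqP; split => w /= wA i; have := wA i; rewrite scale1r.
have := scaled_law i01 (divr_gt0 (sd_gt0 _ t01) (sd_gt0 _ i01)) mA.
rewrite divfK ?gt_eqF ?sd_gt0// => <-.
congr (P _); apply/seteqP; split => w /= wA i; have := wA i;
  by rewrite /normalized_end scalerA.
Qed.

(** Let [h s] be the mean of the bounded function [g (s Z)]. By bounded convergence [h (sd (t k))]
    tends to the mean of [g (X 0)], which is 0. Since [h] is nondecreasing, and positive at every
    [e > 0], eventually [sd (t k) < e]. *)
Lemma cvg_sd (t : R^nat) : (forall k, 0 < t k <= 1) -> t k @[k --> \oo] --> 0 ->
  sd (t k) @[k --> \oo] --> 0.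
Proof.
move=> t01 t0.
pose g (v : 'rV[R]_n.+1) := (Num.min `|v 0 0| 1)%:E.
have mg : measurable_fun setT g.
  apply/measurable_EFinP; apply: measurable_minr => //.
  by apply: measurableT_comp => //; exact: measurable_coord.
have g0 v : (0 <= g v)%E by rewrite lee_fin le_min normr_ge0 ler01.
have g1 v : (g v <= 1)%E by rewrite lee_fin ge_min lexx orbT.
pose Z := normalized_end.
have mZ : measurable_fun setT Z by exact: measurable_normalized_end.
pose h (s : R) := (\int[P]_w g (s *: Z w))%E.
have mgZ s : measurable_fun setT (fun w => g (s *: Z w)).
  by apply: measurableT_comp => //; exact: measurable_rVZ.
have hE k : h (sd (t k)) = (\int[P]_w g (X (t k) w))%E.
  have tk01 : 0 <= t k <= 1 by have /andP[/ltW -> ->] := t01 k.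
  have mXk := X_meas tk01.
  have mZk : measurable_fun setT (fun w => sd (t k) *: Z w) by exact: measurable_rVZ.
  have lawX A : measurable A -> P (X (t k) @^-1` A) = pushforward P (X (t k)) A by [].
  have lawZ A : measurable A ->
      P ((fun w => sd (t k) *: Z w) @^-1` A) = pushforward P (X (t k)) A.
    by move=> mA; rewrite -[RHS]/(P (X (t k) @^-1` A)) process_law.
  transitivity (\int[pushforward P (X (t k))]_v g v)%E.
    exact: (@ge0_integral_law _ _ _ _ _ P _ _ mZk lawZ g mg g0).
  exact/esym/(@ge0_integral_law _ _ _ _ _ P _ _ mXk lawX g mg g0).
have h_nd a b : 0 <= a -> a <= b -> (h a <= h b)%E.
  move=> a0 ab; apply: ge0_le_integral => //.
  move=> w _; rewrite lee_fin le_min !ge_min lexx orbT andbT; apply/orP; left.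
  rewrite !mxE !normrM (ger0_norm a0) (ger0_norm (le_trans a0 ab)).
  by rewrite ler_wpM2r.
(* Otherwise the first coordinate of [X 1] would vanish almost surely, against [coord_nondeg]. *)
have h_gt0 a : 0 < a -> (0 < h a)%E.
  move=> a0; rewrite lt0e; apply/andP; split; last by apply: integral_ge0.
  apply/eqP => ha0.
  have : (\int[P]_w `|g (a *: Z w)| = 0)%E.
    by rewrite -ha0; apply: eq_integral => w _; rewrite gee0_abs.
  move=> /(ae_eq_integral_abs P measurableT (mgZ a)) [N [mN N0 sN]].
  have i01 : 0 < (1 : R) <= 1 by rewrite ltr01 lexx.
  have := coord_nondeg ord0 i01.
  rewrite lt0e => /andP[/eqP + _]; apply.
  have sd1 : 0 < sd 1 by rewrite sqrtr_gt0 variance_function_gt0.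
  apply: (subset_measure0 _ mN) N0.
  - rewrite -[X in measurable X]setTI.
    have mX1 : measurable_fun setT (X 1) by apply: X_meas; rewrite ler01 lexx.
    apply: (measurableT_comp (measurable_coord ord0) mX1 measurableT (Y := [set x : R | x != 0])).
    rewrite (_ : [set _ | _] = ~` [set 0]); first exact: measurableC.
    by apply/seteqP; split=> x /= /eqP.
  - move=> w /= wN0; apply: sN => /= /(_ I) [].
    apply/eqP; rewrite gt_eqF// lt_min ltr01 andbT normr_gt0 /Z /normalized_end !mxE.
    by rewrite !mulf_neq0// ?invr_neq0// gt_eqF.
have h_cvg : h (sd (t k)) @[k --> \oo] --> 0%E.
  have mX0 : measurable_fun setT (X 0) by apply: X_meas; rewrite lexx ler01.
  have m0 : measurable (X 0 @^-1` (~` [set 0])).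
    rewrite -[X in measurable X]setTI; apply: mX0 => //.
    apply: open_measurable_rV; apply: closed_openC.
    exact: accessible_closed_set1 (hausdorff_accessible (@norm_hausdorff _ _)) _.
  have g_int : (\int[P]_w g (X 0 w) = 0)%E.
    transitivity (\int[P]_w `|g (X 0 w)|)%E.
      by apply: eq_integral => w _; rewrite gee0_abs.
    apply/(ae_eq_integral_abs P measurableT); first exact: measurableT_comp.
    exists (X 0 @^-1` (~` [set 0])); split => //.
      rewrite -[LHS]/(P (~` (X 0 @^-1` [set 0]))) probability_setC.
        by rewrite X_start subee.
      by rewrite -[X in measurable X]setCK; exact: measurableC.
    move=> w /=; apply: contra_not => X0 _.
    by rewrite X0 /g mxE normr0 min_l.
  under eq_fun do rewrite hE.
  rewrite -g_int.
  have [|||||_ _ +] := @dominated_convergence _ _ _ P setT measurableT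
    (fun k w => g (X (t k) w)) (fun w => g (X 0 w)) (cst 1%E).
  - move=> k; apply: measurableT_comp => //; apply: X_meas.
    by have /andP[/ltW -> ->] := t01 k.
  - by apply: measurableT_comp => //; apply: X_meas; rewrite lexx ler01.
  - apply: aeW => w _; apply: cvg_EFin; first exact: nearW.
    have Xt : X (t k) w @[k --> \oo] --> X 0 w.
      (* Right-continuity at 0 concerns times strictly above 0; the sequence stays among them since
         [0 < t k]. *)
      have [/(_ 0) + _] := X_cadlag w; rewrite lexx ltr01 => /(_ isT) X0.
      apply: cvg_comp X0 => A [e /= e0 eA].
      have /cvgrPdist_lt/(_ _ e0) te := t0.
      near=> k; apply: eA => /=; last by have /andP[] := t01 k.
      by near: k.
    apply: (cvg_comp (fun k => X (t k) w) (fun v : 'rV[R]_n.+1 => Num.min `|v 0 0| 1) Xt).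
    apply: (@continuous_min R 'rV[R]_n.+1 (fun v => `|v 0 0|) (cst 1)); last exact: cst_continuous.
    apply: (@continuous_comp _ _ _ (fun v : 'rV[R]_n.+1 => v 0 0) Num.norm).
      exact: coord_continuous.
    exact: norm_continuous.
  - exact: finite_measure_integrable_cst.
  - by apply: aeW => w k _; rewrite gee0_abs.
  - by [].
apply/cvgrPdist_lt => e e0.
have hlt : \forall k \near \oo, (h (sd (t k)) < h e)%E.
  exact: (h_cvg _ (open_ereal_lt' (h_gt0 _ e0))).
near=> k.
have : (h (sd (t k)) < h e)%E by near: k.
rewrite sub0r normrN ger0_norm ?sqrtr_ge0//; apply: contraLR; rewrite -!leNgt.
by apply: h_nd; exact: ltW.
Unshelve. all: by end_near. Qed.

End gaussian_process_law.

(** * The heat loss as an expected volume *)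

Section escape.
Context {R : realType} (n : nat) (D : set 'rV[R]_n).
Hypothesis mD : measurable D.

Definition escape (y : 'rV[R]_n) : set 'rV[R]_n := [set x | D x /\ ~ D (x + y)].

Lemma measurable_escape_graph :
  measurable [set p : 'rV[R]_n * 'rV[R]_n | escape p.2 p.1].
Proof.
rewrite (_ : [set _ | _] = fst @^-1` D `&`
    (fun p : 'rV[R]_n * 'rV[R]_n => p.1 + p.2) @^-1` (~` D)); last first.
  by apply/seteqP; split.
apply: measurableI; rewrite -[X in measurable X]setTI.
  exact: measurable_fst.
have madd : measurable_fun setT (fun p : 'rV[R]_n * 'rV[R]_n => p.1 + p.2).
  by apply: measurable_rVD; [exact: measurable_fst|exact: measurable_snd].
by apply: madd => //; exact: measurableC.
Qed.

Lemma measurable_escape y : measurable (escape y).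
Proof.
have := @pair2_measurable _ _ 'rV[R]_n 'rV[R]_n y.
by move=> /(_ measurableT _ measurable_escape_graph); rewrite setTI.
Qed.

Lemma escape_indic x y :
  (\1_[set p : 'rV[R]_n * 'rV[R]_n | escape p.2 p.1] (x, y) = \1_(escape y) x :> R).
Proof. by rewrite !indicE; congr (_%:R); congr nat_of_bool; apply/idP/idP; rewrite !inE. Qed.

Lemma measurable_lebesgue_escape :
  measurable_fun setT (fun y => lebesgue_rV n (escape y)).
Proof.
pose f (p : 'rV[R]_n * 'rV[R]_n) :=
  (\1_[set p : 'rV[R]_n * 'rV[R]_n | escape p.2 p.1] p : R)%:E.
have mf : measurable_fun setT f.
  by apply/measurable_EFinP; apply: measurable_indic; exact: measurable_escape_graph.
have f0 p : (0 <= f p)%E by rewrite lee_fin.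
rewrite (_ : (fun y => _) = (fun y => \int[lebesgue_rV n]_x f (x, y))%E).
  exact: (measurable_fun_fubini_tonelli_G (m1 := lebesgue_rV n) f mf f0).
apply/funext => y; under eq_integral do rewrite /f escape_indic.
by rewrite integral_indic ?setIT//; exact: measurable_escape.
Qed.

Section heat_deficit.
Context d (Omega : measurableType d) (P : probability Omega R).
Variable Y : Omega -> 'rV[R]_n.
Hypotheses (mY : measurable_fun setT Y) (Doo : (lebesgue_rV n D < +oo)%E).

(** For [x] in [D], the complement of staying in [D] has the probability that [x] escapes; by
    Tonelli the integral over [x] may come first. *)
Lemma heat_deficit :
  (lebesgue_rV n D - \int[lebesgue_rV n]_(x in D) P [set w | D (x + Y w)%R] =
   \int[P]_w lebesgue_rV n (escape (Y w)))%E.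
Proof.
pose f (p : 'rV[R]_n * Omega) := (\1_(escape (Y p.2)) p.1 : R)%:E.
have mYp : measurable_fun setT (fun p : 'rV[R]_n * Omega => (p.1, Y p.2)).
  apply/measurable_fun_pairP; split => /=; first exact: measurable_fst.
  by apply: (measurableT_comp mY); exact: measurable_snd.
have mf : measurable_fun setT f.
  apply/measurable_EFinP.
  have mi : measurable_fun setT
      (\1_[set p : 'rV[R]_n * 'rV[R]_n | escape p.2 p.1] : _ -> R).
    by apply: measurable_indic; exact: measurable_escape_graph.
  have := measurableT_comp mi mYp.
  by apply: eq_measurable_fun => p _ /=; rewrite escape_indic.
have f0 p : (0 <= f p)%E by rewrite lee_fin.
have mDx x : measurable [set w | D (x + Y w)].
  rewrite -[X in measurable X]setTI.
  by apply: (measurable_rVD (f := cst x) _ mY).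
have mDc x : measurable [set w | ~ D (x + Y w)] by exact: (measurableC (mDx x)).
have mPD : measurable_fun setT (fun x : 'rV[R]_n => P [set w | D (x + Y w)]).
  pose h (p : 'rV[R]_n * Omega) := (\1_D (p.1 + Y p.2) : R)%:E.
  have mh : measurable_fun setT h.
    apply/measurable_EFinP/measurableT_comp; first exact: measurable_indic.
    apply: measurable_rVD; first exact: measurable_fst.
    by apply: (measurableT_comp mY); exact: measurable_snd.
  have h0 p : (0 <= h p)%E by rewrite lee_fin.
  rewrite (_ : (fun x => _) = (fun x => \int[P]_w h (x, w))%E).
    exact: (measurable_fun_fubini_tonelli_F (m2 := P) h mh h0).
  apply/funext => x; rewrite (eq_integral (fun w => (\1_[set w | D (x + Y w)] w)%:E)).
    by rewrite integral_indic// setIT.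
  by move=> w _; rewrite /h !indicE; congr (_%:R%:E); congr nat_of_bool; apply/idP/idP; rewrite !inE.
have PcE x : P [set w | ~ D (x + Y w)] = (1 - P [set w | D (x + Y w)%R])%E.
  by rewrite -probability_setC.
have mPDc : measurable_fun setT (fun x : 'rV[R]_n => P [set w | ~ D (x + Y w)]).
  under eq_fun do rewrite PcE.
  exact: emeasurable_funB.
transitivity (\int[lebesgue_rV n]_(x in D) P [set w | ~ D (x + Y w)%R])%E; last first.
  transitivity (\int[lebesgue_rV n]_x \int[P]_w f (x, w))%E.
    rewrite integral_mkcond; apply: eq_integral => x _; rewrite patchE.
    case: ifPn => [|/negP] xD.
      rewrite inE in xD.
      rewrite (eq_integral (fun w => (\1_[set w | ~ D (x + Y w)] w)%:E)).
        by rewrite integral_indic// setIT.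
      move=> w _; rewrite /f !indicE; congr (_%:R%:E); congr nat_of_bool.
      by apply/idP/idP; rewrite !inE /escape/=; [case|split].
    rewrite integral0_eq// => w _; rewrite /f indicE memNset// => -[/= Dx _].
    by apply: xD; rewrite inE.
  rewrite fubini_tonelli//; apply: eq_integral => w _.
  by rewrite /f/= integral_indic ?setIT//; exact: measurable_escape.
have -> : lebesgue_rV n D = (\int[lebesgue_rV n]_(x in D) P [set w | ~ D (x + Y w)%R] +
    \int[lebesgue_rV n]_(x in D) P [set w | D (x + Y w)%R])%E.
  rewrite -ge0_integralD//; last 2 first.
  - exact: measurable_funTS.
  - exact: measurable_funTS.
  under eq_integral do rewrite PcE subeK ?fin_num_measure//.
  by rewrite integral_cst// mul1e.
(* Cancellation asks for a finite term: the heat content is at most the volume of [D]. *)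
rewrite addeK//; apply/fin_numPlt; apply/andP; split.
  by rewrite (lt_le_trans (ltNyr 0)) ?integral_ge0.
apply: le_lt_trans Doo.
rewrite -[leRHS]mul1e -(integral_cst _ mD 1%E).
apply: ge0_le_integral => //.
- exact: measurable_funTS.
- by move=> x _; exact: probability_le1.
Qed.

End heat_deficit.

End escape.

(** * Euclidean geometry and charts *)

Section euclidean_norm.
Context {R : realType}.

Lemma enorm_ge0 n (x : 'rV[R]_n) : 0 <= enorm x.
Proof. exact: sqrtr_ge0. Qed.

Lemma enorm0 n : enorm (0 : 'rV[R]_n) = 0.
Proof. by rewrite /enorm big1 ?sqrtr0// => i _; rewrite mxE expr0n. Qed.

Lemma enormZ n (a : R) (x : 'rV[R]_n) : enorm (a *: x) = `|a| * enorm x.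
Proof.
rewrite /enorm -sqrtr_sqr -sqrtrM ?sqr_ge0// mulr_sumr; congr Num.sqrt.
by apply: eq_bigr => i _; rewrite mxE exprMn.
Qed.

Lemma ler_coord_enorm n (x : 'rV[R]_n) i : `|x 0 i| <= enorm x.
Proof.
rewrite -sqrtr_sqr ler_wsqrtr// (bigD1 i)//= lerDl.
by apply: sumr_ge0 => j _; exact: sqr_ge0.
Qed.

Lemma ler_enorm_sum n (x : 'rV[R]_n) : enorm x <= \sum_i `|x 0 i|.
Proof.
rewrite -ler_sqr ?nnegrE ?enorm_ge0 ?sumr_ge0//.
rewrite sqr_sqrtr; last by apply: sumr_ge0 => i _; exact: sqr_ge0.
rewrite expr2 mulr_suml; apply: ler_sum => i _.
rewrite -real_normK ?num_real// expr2 ler_wpM2l//.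
by rewrite (bigD1 i)//= lerDl sumr_ge0.
Qed.

Lemma ler_norm_enorm n (x : 'rV[R]_n) : `|x| <= enorm x.
Proof.
rewrite [leLHS]/Num.norm /= mx_normrE; apply/bigmax_leP; split; first exact: enorm_ge0.
by move=> [i j] _ /=; rewrite (ord1 i) ler_coord_enorm.
Qed.

Lemma continuous_fsum (T : topologicalType) (I : finType) (F : I -> T -> R) :
  (forall i, continuous (F i)) -> continuous (fun x => \sum_i F i x).
Proof.
move=> cF; apply: continuous_big => [|i _]; last exact: cF.
exact: add_continuous.
Qed.

Lemma continuous_enorm n : continuous (@enorm R n).
Proof.
move=> x; apply: (@continuous_comp _ _ _ (fun x : 'rV[R]_n => \sum_i x 0 i ^+ 2) Num.sqrt).
  apply: continuous_fsum => i {}x.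
  by apply: (@continuous_comp _ _ _ (fun x : 'rV[R]_n => x 0 i) (fun y : R => y ^+ 2));
    [exact: coord_continuous|exact: exprn_continuous].
exact: sqrt_continuous.
Qed.

Lemma open_eball n (z : 'rV[R]_n) r : open (eball z r).
Proof.
have cz : continuous (fun x : 'rV[R]_n => enorm (x - z)).
  move=> x; apply: (@continuous_comp _ _ _ (fun x : 'rV[R]_n => x - z) (@enorm R n)).
    by apply: (@cvgB _ _ _ (nbhs x)); [exact: cvg_id|exact: cvg_cst].
  exact: continuous_enorm.
by move/continuousP : cz => /(_ [set x | x < r]); apply; exact: open_lt.
Qed.

Lemma dotr_orth n (w z : 'rV[R]_n) (Q : 'M[R]_n) : dotr w (z *m Q^T) = dotr (w *m Q) z.
Proof. by rewrite !dotrE trmx_mul trmxK mulmxA. Qed.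

(** Cauchy-Schwarz by rotation: with [w = |w| e_0 H] the product is [|w|] times one coordinate of a
    vector of norm [|z|]. *)
Lemma ler_dotr_enorm n (w z : 'rV[R]_n) : `|dotr w z| <= enorm w * enorm z.
Proof.
case: n w z => [|n] w z; first by rewrite /dotr big_ord0 normr0 mulr_ge0 ?enorm_ge0.
have [H [HH wH]] := ex_orth_enorm w.
rewrite {1}wH dotrE -scalemxAl mxE normrM (ger0_norm (enorm_ge0 _)).
rewrite ler_wpM2l ?enorm_ge0//.
have HTH : H^T *m (H^T)^T = 1%:M by rewrite trmxK; exact: mulmx1C.
rewrite -(enorm_orth z HTH) (le_trans _ (ler_coord_enorm _ 0))//.
rewrite -mulmxA -[H in X in `|X|]trmxK -trmx_mul -rowE !mxE.
by [].
Qed.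

End euclidean_norm.

(** * Functions of class C^{1,1} *)

Section C11_functions.
Context {R : realType} (n : nat) (Lambda : R) (phi : 'rV[R]_n -> R).
Hypothesis phiP : C11_function Lambda phi.

Let dphi u : differentiable phi u. Proof. by case: phiP. Qed.

Lemma derive_grad u v : 'D_v phi u = dotr (grad phi u) v.
Proof.
rewrite deriveE// [in LHS](row_sum_delta v) linear_sum/=; apply: eq_bigr => i _.
by rewrite linearZ/= mxE deriveE// mulrC.
Qed.

Lemma continuous_C11 : continuous phi.
Proof. by move=> u; exact: differentiable_continuous. Qed.

Lemma continuous_grad i : continuous (fun u => grad phi u 0 i).
Proof.
move=> u; apply/(@cvgrPdist_le _ _ _ (nbhs u)) => e e0.
have cL : continuous (fun v : 'rV[R]_n => Lambda * enorm (u - v)).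
  move=> x; apply: (@cvgM _ _ (nbhs x)); first exact: cvg_cst.
  apply: (@continuous_comp _ _ _ (fun v : 'rV[R]_n => u - v) (@enorm R n)).
    by apply: (@cvgB _ _ _ (nbhs x)); [exact: cvg_cst|exact: cvg_id].
  exact: continuous_enorm.
have /(@cvgrPdist_le _ _ _ (nbhs u))/(_ _ e0) := cL u.
apply: filterS => v; rewrite subrr enorm0 mulr0 sub0r normrN => /(le_trans (ler_norm _)) uv.
apply: le_trans uv; have [_ _ /(_ u v)] := phiP; apply: le_trans.
by have := ler_coord_enorm (grad phi u - grad phi v) i; rewrite !mxE.
Qed.

(** Mean value theorem along the segment; the derivative is a scalar product with a gradient of norm
    at most [Lambda]. *)
Lemma C11_lipschitz u v : `|phi (u + v) - phi u| <= Lambda * enorm v.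
Proof.
pose g (t : R) := phi (u + t *: v).
(* The quotients of [g] coincide with those of the directional derivative of [phi], which takes the
   place of a chain rule. *)
have quotE (t : R) : (fun h : R => h^-1 *: ((g \o shift t) (h *: (1 : R)) - g t)) =
    (fun h : R => h^-1 *: ((phi \o shift (u + t *: v)) (h *: v) - phi (u + t *: v))).
  apply/funext => h; rewrite /g /=; congr (_ *: (phi _ - _)).
  have -> : h *: (1 : R) = h by exact: mulr1.
  by rewrite scalerDl addrCA.
have dg (t : R) : is_derive t (1 : R) g ('D_v phi (u + t *: v)).
  apply: DeriveDef; rewrite /derivable /derive quotE//.
  exact: diff_derivable.
have [|c _] := @MVT R g (fun t => 'D_v phi (u + t *: v)) 0 1 ltr01.
  by apply: derivable_within_continuous => x _; have [] := dg x.
rewrite /g scale1r scale0r addr0 subr0 mulr1 => ->.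
rewrite derive_grad (le_trans (ler_dotr_enorm _ _))// ler_wpM2r ?enorm_ge0//.
by case: phiP.
Qed.

End C11_functions.

(** * Coordinates of a chart *)

Section charts.
Context {R : realType} (n : nat).

Definition rV_snoc (u : 'rV[R]_n) (h : R) : 'rV[R]_n.+1 :=
  \row_j oapp (u 0) h (unlift ord_max j).

(** Charts put the height last, while [lebesgue_rV] splits off the first coordinate. This
    permutation matrix moves coordinate 0 to the end and, being orthogonal, preserves Lebesgue
    measure. *)
Definition snoc_mx : 'M[R]_n.+1 :=
  \matrix_(i, j) (j == if unlift ord0 i is Some k then lift ord_max k else ord_max)%:R.

Lemma snoc_mx_orth : snoc_mx *m snoc_mx^T = 1%:M.
Proof.
apply/matrixP => i j; rewrite !mxE.
pose f i : 'I_n.+1 := if unlift ord0 i is Some k then lift ord_max k else ord_max.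
have f_inj : injective f.
  move=> a b; rewrite /f; case: unliftP => [a' ->|->]; case: unliftP => [b' ->|->] //.
  - by move=> /lift_inj ->.
  - by move=> /eqP; rewrite eq_sym (negbTE (neq_lift _ _)).
  - by move=> /eqP; rewrite (negbTE (neq_lift _ _)).
under eq_bigr do rewrite !mxE -/(f i) -/(f j).
rewrite (bigD1 (f i))//= eqxx mul1r big1 ?addr0; last first.
  by move=> k /negbTE ->; rewrite mul0r.
by rewrite (inj_eq f_inj).
Qed.

Lemma rV_snocE u h : rV_snoc u h = rV_cons (h, u) *m snoc_mx.
Proof.
apply/rowP => j; rewrite !mxE big_ord_recl rV_cons0 mxE unlift_none.
under eq_bigr do rewrite rV_consS mxE liftK.
case: unliftP => [k ->|->] /=.
  rewrite eq_sym (negbTE (neq_lift _ _)) mulr0 add0r (bigD1 k)//= eqxx mulr1.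
  rewrite big1 ?addr0// => i ik; rewrite (inj_eq lift_inj) eq_sym (negbTE ik) mulr0.
  by [].
rewrite eqxx mulr1 big1 ?addr0// => i _.
by rewrite (negbTE (neq_lift _ _)) mulr0.
Qed.

Lemma rV_snocD u v h k : rV_snoc u h + rV_snoc v k = rV_snoc (u + v) (h + k).
Proof. by apply/rowP => j; rewrite !mxE; case: unliftP => [i _|_] /=; rewrite ?mxE. Qed.

Lemma rV_snoc_inj u v h k : rV_snoc u h = rV_snoc v k -> u = v /\ h = k.
Proof.
move=> /rowP E; split; last by have := E ord_max; rewrite !mxE unlift_none.
by apply/rowP => j; have := E (lift ord_max j); rewrite !mxE liftK.
Qed.

Definition rV_init (y : 'rV[R]_n.+1) : 'rV[R]_n := \row_j y 0 (lift ord_max j).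

Lemma rV_snoc_split y : rV_snoc (rV_init y) (y 0 ord_max) = y.
Proof. by apply/rowP => j; rewrite mxE; case: unliftP => [k ->|->] /=; rewrite ?mxE. Qed.

Lemma dotr_snoc u h v k : dotr (rV_snoc u h) (rV_snoc v k) = dotr u v + h * k.
Proof.
rewrite /dotr big_ord_recr/=; congr (_ + _); last by rewrite !mxE unlift_none.
apply: eq_bigr => i _.
have -> : widen_ord (leqnSn n) i = lift ord_max i by apply/val_inj/esym; exact: lift_max.
by rewrite !mxE liftK.
Qed.

Lemma enorm_snoc u h : enorm (rV_snoc u h) ^+ 2 = enorm u ^+ 2 + h ^+ 2.
Proof. by rewrite !enorm_sqr -!dotrE dotr_snoc expr2. Qed.

Section chart.
Variables (z : 'rV[R]_n.+1) (Q : 'M[R]_n.+1).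
Hypothesis QQ : Q *m Q^T = 1%:M.

Lemma chart_pointE u h : chart_point z Q u h = z + rV_snoc u h *m Q.
Proof. by []. Qed.

Lemma chart_point_cons u h :
  chart_point z Q u h = z + rV_cons (h, u) *m (snoc_mx *m Q).
Proof. by rewrite chart_pointE rV_snocE mulmxA. Qed.

Lemma chart_point_inj u v h k : chart_point z Q u h = chart_point z Q v k -> u = v /\ h = k.
Proof.
move=> /addrI/(congr1 (mulmxr Q^T))/=; rewrite -!mulmxA QQ !mulmx1.
exact: rV_snoc_inj.
Qed.

Lemma chart_point_add u h y :
  chart_point z Q u h + y =
  chart_point z Q (u + rV_init (y *m Q^T)) (h + (y *m Q^T) 0 ord_max).
Proof.
rewrite !chart_pointE -rV_snocD rV_snoc_split mulmxDl -mulmxA (mulmx1C QQ) mulmx1.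
by rewrite addrA.
Qed.

Lemma enorm_chart_point u h : enorm (chart_point z Q u h - z) = enorm (rV_snoc u h).
Proof. by rewrite chart_pointE addrC addKr enorm_orth. Qed.

Lemma measurable_chart_point :
  measurable_fun setT (fun p : R * 'rV[R]_n => chart_point z Q p.2 p.1).
Proof.
rewrite (_ : (fun p => _) = (fun x => z + x) \o (fun p => rV_cons p *m (snoc_mx *m Q))).
  apply: measurableT_comp; first exact: measurable_rVD.
  apply: (measurableT_comp (measurable_mulmxr _)); exact: measurable_rV_cons.
by apply/funext => -[h u] /=; rewrite chart_point_cons.
Qed.

(** The chart map is the orthogonal map [snoc_mx *m Q] followed by a translation, so the volume
    element is [du dh]. *)
Lemma ge0_integral_chart (f : 'rV[R]_n.+1 -> \bar R) :
  measurable_fun setT f -> (forall x, 0 <= f x)%E ->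
  (\int[lebesgue_rV n.+1]_x f x =
   \int[lebesgue_rV n]_u \int[lebesgue_measure]_h f (chart_point z Q u h))%E.
Proof.
move=> mf f0.
have mzf : measurable_fun setT (fun x => f (z + x)).
  by apply: measurableT_comp => //; exact: measurable_rVD.
rewrite -(ge0_integral_rV_affine z (or_introl erefl) mf f0).
under eq_integral do rewrite scale1r addrC.
have SS : (snoc_mx *m Q) *m (snoc_mx *m Q)^T = 1%:M.
  by rewrite trmx_mul mulmxA -(mulmxA snoc_mx) QQ mulmx1 snoc_mx_orth.
rewrite -(ge0_integral_rV_orth SS mzf)//.
have mk : measurable_fun setT (fun x => f (z + x *m (snoc_mx *m Q))).
  by apply: (measurableT_comp mzf); exact: measurable_mulmxr.
apply: (etrans (ge0_integral_rV_cons mk (fun x => f0 _))).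
apply: eq_integral => u _; apply: eq_integral => h _.
by congr (f _); exact/esym/chart_point_cons.
Qed.

Lemma continuous_chart_point u : continuous (chart_point z Q u).
Proof.
have E h : chart_point z Q u h = chart_point z Q u 0 + h *: (rV_snoc 0 1 *m Q).
  rewrite !chart_pointE -addrA scalemxAl -mulmxDl; congr (_ + _ *m _).
  apply/rowP => j; rewrite !mxE; case: unliftP => [i _|_] /=.
    by rewrite !mxE mulr0 addr0.
  by rewrite mulr1 add0r.
have -> : chart_point z Q u = (fun h => chart_point z Q u 0 + h *: (rV_snoc 0 1 *m Q)).
  exact/funext.
move=> h.
apply: cvgD; first exact: cvg_cst.
by apply: cvgZr_tmp; exact: cvg_id.
Qed.

End chart.

End charts.

(** * Limits of averages *)

Section averages.
Context {R : realType}.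

(** A convergent [l] is bounded, so a small relative error is a small absolute one. This serves for
    the layer over one point and for the comparison of [G] with the weighted volumes. *)
Lemma cvg_relative (x l : R^nat) (c a : R) :
  (forall e, 0 < e -> \forall k \near \oo, `|x k - c * l k| <= e * l k) ->
  l k @[k --> \oo] --> a -> x k @[k --> \oo] --> c * a.
Proof.
move=> xl la.
have d0 : x k - c * l k @[k --> \oo] --> 0.
  apply/cvgrPdist_le => e e0.
  have a1 : 0 < `|a| + 1 by rewrite ltr_wpDl.
  have ea : 0 < e / (`|a| + 1) by rewrite divr_gt0.
  have /cvgrPdist_le/(_ _ ltr01) l1 := la.
  near=> k.
  have : `|x k - c * l k| <= e / (`|a| + 1) * l k by near: k; exact: xl.
  rewrite sub0r normrN => /le_trans; apply.
  rewrite mulrAC ler_pdivrMr// ler_wpM2l ?(ltW e0)//.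
  have : `|a - l k| <= 1 by near: k.
  rewrite distrC => lk1.
  rewrite -[l k](subrK a) addrC lerD// ?ler_norm//.
  exact: le_trans (ler_norm _) lk1.
rewrite -[X in _ --> X](add0r (c * a)).
have -> : x = (fun k => x k - c * l k) \+ (cst c \* l).
  by apply/funext => k /=; rewrite subrK.
by apply: cvgD => //; apply: cvgM => //; exact: cvg_cst.
Unshelve. all: by end_near. Qed.

Lemma cvg_max0 (l : R^nat) (a : R) : l k @[k --> \oo] --> a ->
  Num.max (l k) 0 @[k --> \oo] --> Num.max a 0.
Proof.
move=> la; apply: (cvg_comp _ (fun x : R => Num.max x 0) la).
apply: (@continuous_max R R id (cst 0)); last exact: cst_continuous.
exact: cvg_id.
Qed.

(** The positive part in the flux originates here: for [l <= 0] the interval is empty. *)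
Lemma integral_itv_cst (b l c : R) : 0 <= c ->
  (\int[lebesgue_measure]_(h in `]b, (b + l)%R]) c%:E = (c * Num.max l 0)%:E)%E.
Proof.
move=> c0; rewrite integral_cst//= lebesgue_measure_itv/= lte_fin ltrDl.
case: (ltP 0 l) => l0; last by rewrite mulr0 mule0.
by rewrite -EFinB -EFinM addrAC subrr add0r.
Qed.

(** On a short interval [f] is within [e] of [f b], so the integral is [f b] times the length up to
    [e] times the length. *)
Lemma cvg_itv_average (f : R -> R) (b a : R) (l s : R^nat) :
  continuous f -> (forall h, 0 <= f h) -> (forall k, 0 < s k) ->
  s k @[k --> \oo] --> 0 -> l k / s k @[k --> \oo] --> a ->
  ((s k)^-1%:E * \int[lebesgue_measure]_(h in `]b, (b + l k)%R]) (f h)%:E)%E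
    @[k --> \oo] --> (f b * Num.max a 0)%:E.
Proof.
move=> cf f0 s0 s_0 ls.
have l_0 : l k @[k --> \oo] --> 0.
  have -> : l = s \* (fun k => l k / s k).
    by apply/funext => k /=; rewrite mulrC divfK// gt_eqF.
  by rewrite -(mul0r a); exact: cvgM.
have mf D : measurable D -> measurable_fun D (EFin \o f).
  move=> mD; apply/measurable_EFinP/measurable_funTS.
  exact: continuous_measurable_fun.
pose I k := (\int[lebesgue_measure]_(h in `]b, (b + l k)%R]) (f h)%:E)%E.
(* The lower constant is cut off at 0 because the integrals compared are those of nonnegative
   functions. *)
have bnd e : 0 < e -> \forall k \near \oo,
    ((Num.max (f b - e) 0 * Num.max (l k) 0)%:E <= I k <= ((f b + e) * Num.max (l k) 0)%:E)%E.
  move=> e0; have /cvgrPdist_lt/(_ _ e0)[d /= d0 fd] := cf b.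
  have /cvgrPdist_lt/(_ _ d0) ld := l_0.
  near=> k.
  have lkd : `|l k| < d by rewrite -normrN -sub0r; near: k.
  have fh h : h \in `]b, (b + l k)%R] -> `|f b - f h| < e.
    rewrite in_itv/= => /andP[bh hl]; apply: fd => /=.
    rewrite distrC gtr0_norm ?subr_gt0//.
    by rewrite (le_lt_trans _ lkd)// (le_trans _ (ler_norm _))// lerBlDl.
  have fbe : 0 <= f b + e by rewrite addr_ge0// ltW.
  have mx0 : 0 <= Num.max (f b - e) 0 by rewrite le_max lexx orbT.
  rewrite -!(integral_itv_cst b)//; apply/andP; split; apply: ge0_le_integral => //.
  - exact: mf.
  - move=> h /= hI; rewrite lee_fin ge_max f0 andbT.
    by have := fh h hI; rewrite ltr_distl => /andP[/ltW]; lra.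
  - by move=> h _; rewrite lee_fin.
  - exact: mf.
  - move=> h /= hI; rewrite lee_fin.
    by have := fh h hI; rewrite ltr_distl => /andP[]; lra.
have Ifin : \forall k \near \oo, I k \is a fin_num.
  near=> k; have /andP[I1 I2] : ((Num.max (f b - 1) 0 * Num.max (l k) 0)%:E <= I k <= ((f b + 1) * Num.max (l k) 0)%:E)%E.
    by near: k; exact: bnd.
  by rewrite ge0_fin_numE ?(le_lt_trans I2 (ltry _))// integral_ge0// => h _; rewrite lee_fin.
suff : (EFin \o (fun k => (s k)^-1 * fine (I k))) k @[k --> \oo] --> (f b * Num.max a 0)%:E.
  apply: cvg_trans; apply: near_eq_cvg; near=> k.
  by rewrite /= EFinM fineK//; near: k.
apply: cvg_EFin; first exact: nearW.
apply: cvg_relative (cvg_max0 ls) => e e0.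
near=> k.
have sk0 := s0 k.
have Ik : I k \is a fin_num by near: k.
have : ((Num.max (f b - e) 0 * Num.max (l k) 0)%:E <= I k <= ((f b + e) * Num.max (l k) 0)%:E)%E.
  by near: k; exact: bnd.
rewrite -(fineK Ik) !lee_fin /= => /andP[I1 I2].
have -> : Num.max (l k / s k) 0 = (s k)^-1 * Num.max (l k) 0.
  by rewrite maxr_pMr ?invr_ge0 ?ltW// mulr0 mulrC.
set m := Num.max (l k) 0 in I1 I2 *.
have m0 : 0 <= m by rewrite le_max lexx orbT.
rewrite mulrCA -mulrBr normrM gtr0_norm ?invr_gt0// mulrCA ler_wpM2l ?invr_ge0 ?(ltW sk0)//.
rewrite ler_distl; apply/andP; split; last by rewrite -mulrDl.
apply: le_trans I1; rewrite -mulrBl ler_wpM2r//.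
by rewrite le_max lexx.
Unshelve. all: by end_near. Qed.

End averages.

(** * The volume lost in one chart *)

Section compactness.
Context {R : realType}.

(** Continuity of addition gives a margin near each point, and compactness, as [near_covering],
    makes it uniform. *)
Lemma compact_open_margin n (K U : set 'rV[R]_n) : compact K -> open U -> K `<=` U ->
  exists2 d, 0 < d & forall x y, K x -> enorm y < d -> U (x + y).
Proof.
move=> cK oU KU.
have ncK : near_covering K by exact/compact_near_coveringP.
have /nbhs_ballP[d /= d0 dU] : nbhs (0 : 'rV[R]_n) (fun y => K `<=` (fun x => U (x + y))).
  apply: (ncK _ (nbhs (0 : 'rV[R]_n)) (fun y x => U (x + y)) (nbhs_filter _)).
  move=> x Kx.
  have Ux : nbhs (x + 0) U by rewrite addr0; exact/open_nbhs_nbhs/(conj oU)/KU.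
  have [[A B] /= [A1 B1] AB] := @add_continuous 'rV[R]_n (x, 0) U Ux.
  by exists (A, B) => //= -[a b] [/= Aa Bb]; exact: (AB (a, b)).
exists d => // x y Kx yd; apply: dU Kx.
rewrite -ball_normE /ball_/= sub0r normrN.
exact: le_lt_trans (ler_norm_enorm _) yd.
Qed.

Lemma bounded_enorm n (A : set 'rV[R]_n) (M : R) :
  (forall x, A x -> enorm x <= M) -> bounded_set A.
Proof.
move=> AM; exists M; split; first exact: num_real.
move=> N MN x Ax; apply: le_trans (ler_norm_enorm x) _.
exact: le_trans (AM _ Ax) (ltW MN).
Qed.

Lemma lebesgue_rV_bounded n (A : set 'rV[R]_n) (M : R) : measurable A ->
  (forall x, A x -> enorm x <= M) -> (lebesgue_rV n A < +oo)%E.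
Proof.
move=> mA AM.
pose B := [set x : 'rV[R]_n | forall i, `[(- M)%R, M]%classic (x 0 i)].
have mB : measurable B.
  rewrite (_ : B = \bigcap_(i in [set: 'I_n])
     [set x : 'rV[R]_n | `[(- M)%R, M]%classic (x 0 i)]); last first.
    by apply/seteqP; split => x Ax i; [move=> _; exact: Ax|exact: (Ax i I)].
  apply: fin_bigcap_measurable => // i _.
  by rewrite -[X in measurable X]setTI; exact: measurable_coord.
have AB : A `<=` B.
  move=> x /AM xM i; rewrite /= in_itv/= -ler_norml.
  exact: le_trans (ler_coord_enorm _ _) xM.
apply: (@le_lt_trans _ _ (lebesgue_rV n B)); first by rewrite le_measure// inE.
rewrite (@lebesgue_rV_box R n (fun=> `[(- M)%R, M]%classic) (fun=> measurable_itv _)).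
suff : (\prod_(i < n) lebesgue_measure `[(- M)%R, M] \is a fin_num)%E.
  by rewrite fin_numElt => /andP[].
elim/big_ind: _ => // [a b|i _]; first exact: fin_numM.
by rewrite /= lebesgue_measure_itv/=; case: ifP => _; rewrite -?EFinB.
Qed.

Lemma continuous_enorm_sub n (z : 'rV[R]_n) : continuous (fun x : 'rV[R]_n => enorm (x - z)).
Proof.
move=> x; apply: (@continuous_comp _ _ _ (fun x : 'rV[R]_n => x - z) (@enorm R n)).
  by apply: (@cvgB _ _ _ (nbhs x)); [exact: cvg_id|exact: cvg_cst].
exact: continuous_enorm.
Qed.

Lemma bounded_eball n (A : set 'rV[R]_n) (z : 'rV[R]_n) (r : R) :
  A `<=` eball z r -> bounded_set A.
Proof.
move=> Ar; exists (r + `|z|); split; first exact: num_real.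
move=> N MN x /Ar xr; apply: le_trans (ltW MN).
rewrite -[x in `|x|](subrK z) (le_trans (ler_normD _ _))// lerD2r.
exact: le_trans (ler_norm_enorm _) (ltW xr).
Qed.

End compactness.

Section chart_layer.
Context {R : realType} (n : nat).
Variables (D : set 'rV[R]_n.+1) (r Lambda : R) (z : 'rV[R]_n.+1)
  (Q : 'M[R]_n.+1) (phi : 'rV[R]_n -> R) (chi : 'rV[R]_n.+1 -> R).
Hypotheses (mD : measurable D) (chartD : C11_chart D r Lambda z Q phi)
  (L0 : 0 < Lambda).
Hypotheses (cchi : continuous chi) (chi0 : forall x, 0 <= chi x)
  (chir : closure [set x | chi x != 0] `<=` eball z r).

Let QQ : Q *m Q^T = 1%:M. Proof. by case: chartD. Qed.
Let phiP : C11_function Lambda phi. Proof. by case: chartD. Qed.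
Let K := closure [set x | chi x != 0].

Let mchi : measurable_fun setT chi.
Proof. exact: continuous_measurable_rV. Qed.

Let mphi : measurable_fun setT phi.
Proof. by apply: continuous_measurable_rV; exact: continuous_C11 phiP. Qed.

Let compactK : compact K.
Proof.
apply: bounded_closed_compact; last exact: closed_closure.
exact: bounded_eball chir.
Qed.

Let continuous_chi_chart u : continuous (fun h => chi (chart_point z Q u h)).
Proof.
move=> h; apply: (@continuous_comp _ _ _ (chart_point z Q u) chi); last exact: cchi.
exact: continuous_chart_point.
Qed.

(** [chi] vanishes off the compact [K], where it attains a maximum; if [K] is empty, [chi] is
    zero. *)
Lemma chart_bounded : exists2 M, 0 <= M & forall x, chi x <= M.
Proof.
have [Kx0|K0] := pselect (K !=set0); last first.
  exists 0 => // x; rewrite leNgt; apply/negP => /lt0r_neq0 x0; apply: K0.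
  by exists x; exact: subset_closure.
have [c _ cM] := compact_EVT_max Kx0 compactK (continuous_subspaceT cchi).
exists (chi c) => // x; have [->|x0] := eqVneq (chi x) 0; first exact: chi0.
by apply: cM; rewrite inE; exact: subset_closure.
Qed.

(** The chart only provides some coordinates of a point of [D]; they are the given ones because [Q]
    is orthogonal, which makes coordinates unique. *)
Lemma chart_mem u h : eball z r (chart_point z Q u h) ->
  D (chart_point z Q u h) <-> phi u < h.
Proof.
move=> bx; case: chartD => _ _ _ _ /seteqP[sub1 sub2]; split => [Dx|uh].
  have [_ [v [k [vk]]]] := sub1 _ (conj bx Dx).
  by move=> /(chart_point_inj QQ)[-> ->].
by have [] := sub2 (chart_point z Q u h) (conj bx (ex_intro _ u (ex_intro _ h (conj uh erefl)))).
Qed.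

(* In the chart, x = (u, h) lies in D while x + y does not iff
   phi u < h <= chart_top y u. *)
Definition chart_top (y : 'rV[R]_n.+1) (u : 'rV[R]_n) : R :=
  phi (u + rV_init (y *m Q^T)) - (y *m Q^T) 0 ord_max.

Definition chart_layer (y : 'rV[R]_n.+1) (u : 'rV[R]_n) : \bar R :=
  (\int[lebesgue_measure]_(h in `](phi u), (chart_top y u)])
    (chi (chart_point z Q u h))%:E)%E.

Let layer_fun (y : 'rV[R]_n.+1) (p : measurableTypeR R * 'rV[R]_n) : \bar R :=
  (chi (chart_point z Q p.2 p.1) *
   \1_[set p : measurableTypeR R * 'rV[R]_n | phi p.2 < p.1 <= chart_top y p.2] p)%:E.

Let measurable_layer_fun y : measurable_fun setT (layer_fun y).
Proof.
pose S := [set p : measurableTypeR R * 'rV[R]_n | phi p.2 < p.1 <= chart_top y p.2].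
have m1 : measurable_fun setT (fun p : measurableTypeR R * 'rV[R]_n => p.1).
  exact: measurable_fst.
have mphi2 (c : 'rV[R]_n) :
    measurable_fun setT (fun p : measurableTypeR R * 'rV[R]_n => phi (p.2 + c)).
  apply: (measurableT_comp mphi); apply: measurable_rVD => //; exact: measurable_snd.
have mS : measurable S.
  rewrite (_ : S = (fun p => p.1 - phi (p.2 + 0)) @^-1` `]0, +oo[ `&`
      (fun p => phi (p.2 + rV_init (y *m Q^T)) - (y *m Q^T) 0 ord_max - p.1) @^-1` `[0, +oo[).
    apply: measurableI; rewrite -[X in measurable X]setTI.
      by apply: (measurable_funB m1 (mphi2 0)).
    by apply: (measurable_funB (measurable_funB (mphi2 _) _) m1).
  apply/seteqP; split => p /=; rewrite !in_itv/= !andbT addr0 subr_gt0 subr_ge0.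
    by move=> /andP.
  by move=> [? ?]; apply/andP.
apply/measurable_EFinP/measurable_funM; last exact: measurable_indic.
apply: measurableT_comp => //; exact: measurable_chart_point.
Qed.

Let layer_fun_ge0 y p : (0 <= layer_fun y p)%E.
Proof. by rewrite lee_fin mulr_ge0. Qed.

Let chart_layerE y u : chart_layer y u = (\int[lebesgue_measure]_h layer_fun y (h, u))%E.
Proof.
rewrite /chart_layer integral_mkcond; apply: eq_integral => h _.
rewrite patchE /layer_fun indicE.
have -> : (h \in `](phi u), (chart_top y u)]%classic) =
    ((h, u) \in [set p : measurableTypeR R * 'rV[R]_n | phi p.2 < p.1 <= chart_top y p.2]).
  by apply/idP/idP; rewrite !inE/= ?in_itv.
by case: ifP => _; rewrite ?mulr1 ?mulr0.
Qed.

Lemma measurable_chart_layer y : measurable_fun setT (chart_layer y).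
Proof.
rewrite (_ : chart_layer y = fun u => (\int[lebesgue_measure]_h layer_fun y (h, u))%E).
  exact: (measurable_fun_fubini_tonelli_G (m1 := lebesgue_measure) (layer_fun y)).
by apply/funext => u; exact: chart_layerE.
Qed.

Lemma chart_layer_ge0 y u : (0 <= chart_layer y u)%E.
Proof. by apply: integral_ge0 => h _; rewrite lee_fin. Qed.

Definition weighted_escape (y : 'rV[R]_n.+1) : \bar R :=
  (\int[lebesgue_rV n.+1]_x (chi x * \1_(escape D y) x)%:E)%E.

(** [d] is the margin of the support of [chi] inside the ball. Where [chi x] is nonzero, both [x]
    and [x + y] lie in the ball, and their membership in [D] is read off from [phi]. *)
Lemma weighted_escape_chart : exists2 d, 0 < d & forall y, enorm y < d ->
  weighted_escape y = (\int[lebesgue_rV n]_u chart_layer y u)%E.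
Proof.
have [d d0 dK] := compact_open_margin compactK (@open_eball _ _ z r) chir.
exists d => // y yd; rewrite /weighted_escape (ge0_integral_chart z QQ); last 2 first.
- apply/measurable_EFinP/measurable_funM => //.
  by apply: measurable_indic; exact: measurable_escape.
- by move=> x; rewrite lee_fin mulr_ge0.
apply: eq_integral => u _; rewrite chart_layerE; apply: eq_integral => h _.
rewrite /layer_fun/=; have [->|x0] := eqVneq (chi (chart_point z Q u h)) 0.
  by rewrite !mul0r.
congr (_ * _)%:E; rewrite !indicE; congr (_%:R); congr nat_of_bool.
have Kx : K (chart_point z Q u h) by exact: subset_closure.
have bx := chir Kx.
have := dK _ y Kx yd; rewrite (chart_point_add z QQ) => bxy.
have mx := chart_mem bx; have mxy := chart_mem bxy.
apply/idP/idP; rewrite !inE /escape/= (chart_point_add z QQ).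
  move=> [/mx -> /mxy /negP]; rewrite -leNgt /chart_top => /= xy.
  by rewrite lerBrDr.
move=> /andP[/mx Dx xy]; split => // /mxy; apply/negP; rewrite -leNgt.
by rewrite -lerBrDr.
Qed.

Let ball_base := [set u : 'rV[R]_n | enorm u < r].

Let mball : measurable ball_base.
Proof.
apply: open_measurable_rV; have := @open_eball R n 0 r.
by congr open; apply/seteqP; split => u; rewrite /eball/ball_base/= subr0.
Qed.

Let ball_fin : (lebesgue_rV n ball_base < +oo)%E.
Proof. by apply: (lebesgue_rV_bounded (M := r)) => // u /ltW. Qed.

Let chi_base u h : chi (chart_point z Q u h) != 0 -> enorm u < r.
Proof.
move=> x0; have : eball z r (chart_point z Q u h) by apply: chir; exact: subset_closure.
rewrite /eball/= (enorm_chart_point z QQ); apply: le_lt_trans.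
by rewrite -ler_sqr ?nnegrE ?enorm_ge0// enorm_snoc lerDl sqr_ge0.
Qed.

Let enorm_init_le y : enorm (rV_init (y *m Q^T)) <= enorm y.
Proof.
have QTQ : Q^T *m (Q^T)^T = 1%:M by rewrite trmxK; exact: mulmx1C.
rewrite -[leRHS](enorm_orth y QTQ) -ler_sqr ?nnegrE ?enorm_ge0//.
by rewrite -[in leRHS](rV_snoc_split (y *m Q^T)) enorm_snoc lerDl sqr_ge0.
Qed.

Let coord_max_le y : `|(y *m Q^T) 0 ord_max| <= enorm y.
Proof.
have QTQ : Q^T *m (Q^T)^T = 1%:M by rewrite trmxK; exact: mulmx1C.
by rewrite -[leRHS](enorm_orth y QTQ) ler_coord_enorm.
Qed.

(** Writing [y] as [(y', y_n)] in the chart, the layer has height at most [Lambda |y'| + |y_n|], and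
    it carries no weight unless [enorm u < r]. Being linear in [y], the bound dominates the rescaled
    layers uniformly. *)
Lemma chart_layer_le M y u : 0 <= M -> (forall x, chi x <= M) ->
  (chart_layer y u <= (M * (Lambda + 1) * enorm y * \1_ball_base u)%:E)%E.
Proof.
move=> M0 chiM; rewrite indicE; have [uB|/negP uB] := boolP (u \in ball_base); last first.
  rewrite mulr0 /chart_layer integral0_eq// => h _; congr EFin; apply/eqP.
  by apply: contra_notT uB => /chi_base ?; rewrite inE.
rewrite mulr1 /chart_layer -[chart_top y u](subrK (phi u)) addrC.
apply: (@le_trans _ _ (M * Num.max (chart_top y u - phi u) 0)%:E).
  rewrite -(integral_itv_cst (phi u))//; apply: ge0_le_integral => //.
  - by move=> h _; rewrite lee_fin.
  - apply/measurable_EFinP/measurable_funTS.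
    by apply: continuous_measurable_fun; exact: continuous_chi_chart.
  - by move=> h _; rewrite lee_fin.
rewrite lee_fin -mulrA ler_wpM2l// ge_max; apply/andP; split; last first.
  by rewrite mulr_ge0 ?enorm_ge0// addr_ge0// ltW.
rewrite /chart_top mulrDl mul1r addrAC lerD//; last first.
  by rewrite (le_trans _ (coord_max_le y))// -normrN ler_norm.
apply: le_trans (ler_norm _) _; apply: le_trans (C11_lipschitz phiP _ _) _.
by rewrite ler_wpM2l ?(ltW L0).
Qed.

Lemma weighted_escape_le : exists C d, [/\ 0 <= C, 0 < d &
  forall y, enorm y < d -> (weighted_escape y <= (C * enorm y)%:E)%E].
Proof.
have [M M0 chiM] := chart_bounded.
have [d d0 dE] := weighted_escape_chart.
exists (M * (Lambda + 1) * fine (lebesgue_rV n ball_base)), d; split => //.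
  by rewrite !mulr_ge0// ?addr_ge0// ?(ltW L0)// fine_ge0.
move=> y yd; rewrite dE//.
apply: (@le_trans _ _ (\int[lebesgue_rV n]_u (M * (Lambda + 1) * enorm y * \1_ball_base u)%:E)%E).
  apply: ge0_le_integral => //.
  - by move=> u _; exact: chart_layer_ge0.
  - exact: measurable_chart_layer.
  - by apply/measurable_EFinP/measurable_funM => //; exact: measurable_indic.
  - by move=> u _; exact: chart_layer_le.
under eq_integral do rewrite EFinM.
rewrite ge0_integralZl//; last 2 first.
- by apply/measurable_EFinP; exact: measurable_indic.
- by rewrite lee_fin !mulr_ge0 ?enorm_ge0// addr_ge0// ltW.
rewrite integral_indic// setIT -[X in (_ * X)%E]fineK ?ge0_fin_numE//.
by rewrite -EFinM lee_fin mulrAC.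
Qed.

(** The vector [(grad phi, -1) Q] is an outer normal, as [D] lies above the graph, and its length is
    the area density. So this is the surface integral of [chi (y . nu)^+]. *)
Definition surface_flux (y : 'rV[R]_n.+1) : \bar R :=
  (\int[lebesgue_rV n]_u (chi (chart_point z Q u (phi u)) *
     Num.max (dotr (rV_snoc (grad phi u) (-1) *m Q) y) 0)%:E)%E.

Let dot_normal u y : dotr (rV_snoc (grad phi u) (-1) *m Q) y =
  'D_(rV_init (y *m Q^T)) phi u - (y *m Q^T) 0 ord_max.
Proof.
rewrite -dotr_orth -[in LHS](rV_snoc_split (y *m Q^T)) dotr_snoc mulN1r.
by rewrite (derive_grad phiP).
Qed.

(** The rescaled height of the layer is a difference quotient of [phi] in the horizontal direction
    of [y], minus the vertical component of [y]. *)
Let quotient_cvg u y (s : R^nat) : (forall k, 0 < s k) -> s k @[k --> \oo] --> 0 ->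
  (chart_top (s k *: y) u - phi u) / s k @[k --> \oo] -->
  dotr (rV_snoc (grad phi u) (-1) *m Q) y.
Proof.
move=> s0 s_0; rewrite dot_normal.
set v := rV_init (y *m Q^T); set c := (y *m Q^T) 0 ord_max.
have -> : (fun k => (chart_top (s k *: y) u - phi u) / s k) =
    (fun k => (s k)^-1 *: (phi (s k *: v + u) - phi u) - c).
  apply/funext => k; rewrite /chart_top -scalemxAl.
  have -> : rV_init (s k *: (y *m Q^T)) = s k *: v.
    by apply/rowP => j; rewrite !mxE.
  rewrite mxE -/c [u + _]addrC addrAC mulrBl [s k * c]mulrC mulfK ?gt_eqF//.
  by rewrite mulrC.
apply: cvgB; last exact: cvg_cst.
have dphi : derivable phi u v by apply: diff_derivable; case: phiP.
apply: (cvg_comp s (fun h => h^-1 *: (phi (h *: v + u) - phi u)) _ dphi).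
move=> A [e /= e0 eA]; have /cvgrPdist_lt/(_ _ e0) se := s_0.
near=> k; apply: eA => /=; first by near: k.
by rewrite gt_eqF.
Unshelve. all: by end_near. Qed.

(** Over each [u] the layer shrinks to the point of the graph and [cvg_itv_average] gives the limit;
    [g] dominates. Finiteness is recorded because the fluxes of the charts are later added as
    reals. *)
Lemma weighted_escape_cvg y (s : R^nat) : (forall k, 0 < s k) ->
  s k @[k --> \oo] --> 0 ->
  surface_flux y \is a fin_num /\
  ((s k)^-1%:E * weighted_escape (s k *: y))%E @[k --> \oo] --> surface_flux y.
Proof.
move=> s0 s_0.
have [M M0 chiM] := chart_bounded.
have [d d0 dE] := weighted_escape_chart.
pose g u := (M * (Lambda + 1) * enorm y * \1_ball_base u)%:E.
have B0 : 0 <= M * (Lambda + 1) * enorm y.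
  by rewrite !mulr_ge0 ?enorm_ge0// addr_ge0// ltW.
have [|||||ig _ hc] := @dominated_convergence _ _ _ (lebesgue_rV n) setT measurableT
    (fun k u => (s k)^-1%:E * chart_layer (s k *: y) u)%E
    (fun u => (chi (chart_point z Q u (phi u)) *
     Num.max (dotr (rV_snoc (grad phi u) (-1) *m Q) y) 0)%:E) g.
- move=> k; apply: emeasurable_funM => //; exact: measurable_chart_layer.
- apply/measurable_EFinP/measurable_funM.
    apply: (measurableT_comp mchi).
    have mpu : measurable_fun setT (fun u : 'rV[R]_n => (phi u, u)).
      by apply/measurable_fun_pairP; split; [exact: mphi|exact: measurable_id].
    exact: (measurableT_comp (@measurable_chart_point _ _ z Q) mpu).
  apply: measurable_maxr => //.
  under eq_fun do rewrite dot_normal (derive_grad phiP).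
  apply: measurable_funB => //; apply: measurable_sum => i; apply: measurable_funM => //.
  by apply: continuous_measurable_rV; exact: (continuous_grad phiP).
- apply: aeW => u _.
  have E k : phi u + (chart_top (s k *: y) u - phi u) = chart_top (s k *: y) u.
    by rewrite addrC subrK.
  have := @cvg_itv_average R (fun h => chi (chart_point z Q u h)) (phi u)
    (dotr (rV_snoc (grad phi u) (-1) *m Q) y)
    (fun k => chart_top (s k *: y) u - phi u) s (@continuous_chi_chart u)
    (fun h => chi0 _) s0 s_0 (@quotient_cvg u y s s0 s_0).
  by under eq_fun do rewrite E.
- have mgB : measurable_fun setT g.
    by apply/measurable_EFinP/measurable_funM => //; exact: measurable_indic.
  apply/integrableP; split => //.
  rewrite (eq_integral (fun u => (M * (Lambda + 1) * enorm y)%:E * (\1_ball_base u)%:E)%E); last first.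
    by move=> u _; rewrite /g gee0_abs; [rewrite EFinM|rewrite lee_fin mulr_ge0].
  rewrite ge0_integralZl//; last by apply/measurable_EFinP; exact: measurable_indic.
  by rewrite integral_indic// setIT lte_mul_pinfty.
- apply: aeW => u k _.
  have sk0 := s0 k.
  have sV0 : (0 <= (s k)^-1%:E)%E by rewrite lee_fin invr_ge0 ltW.
  rewrite gee0_abs; last by rewrite mule_ge0// chart_layer_ge0.
  apply: le_trans (lee_wpmul2l sV0 (chart_layer_le (s k *: y) u M0 chiM)) _.
  rewrite -EFinM lee_fin enormZ gtr0_norm// le_eqVlt; apply/orP; left.
  by apply/eqP; field; rewrite gt_eqF.
split; first exact: integrable_fin_num ig.
move: hc; apply: cvg_trans; apply: near_eq_cvg.
have sy : s k * enorm y @[k --> \oo] --> 0.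
  by rewrite -(mul0r (enorm y)); apply: cvgM => //; exact: cvg_cst.
have /cvgrPdist_lt/(_ _ d0) syd := sy.
near=> k; have sk0 := s0 k; rewrite dE; last first.
  rewrite enormZ gtr0_norm//; apply: le_lt_trans (ler_norm _) _.
  by rewrite -normrN -sub0r; near: k.
rewrite /= ge0_integralZl//.
- exact: measurable_chart_layer.
- by move=> u _; exact: chart_layer_ge0.
- by rewrite lee_fin invr_ge0 ltW.
Unshelve. all: by end_near. Qed.

End chart_layer.

(** * The volume lost by a translation *)

Section boundary_layer.
Context {R : realType} (n : nat) (D : set 'rV[R]_n).
Hypotheses (oD : open D) (bD : bounded_set D).

(** Off the frontier, closure and interior agree. If the segment missed it, the parameters [t] with
    [x + t *: y] in [D] would be open and closed in [[0, 1]], hence all of it, against the end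
    point. *)
Lemma escape_crossing x y : escape D y x ->
  exists2 t, 0 <= t <= 1 & frontier D (x + t *: y).
Proof.
move=> [Dx Dxy]; apply: contrapT => noF.
pose f (t : R) := x + t *: y.
have cf : continuous f.
  by move=> t; apply: cvgD; [exact: cvg_cst|exact: scalel_continuous].
have [f0 f1] : f 0 = x /\ f 1 = x + y by rewrite /f scale0r addr0 scale1r.
pose B := `[0, 1]%classic `&` f @^-1` D.
have BE : B = `[0, 1]%classic `&` f @^-1` closure D.
  apply/seteqP; split => t [t01 Dt]; split => //; first exact: subset_closure.
  apply: contrapT => nDt; apply: noF; exists t; first by move: t01; rewrite /= in_itv.
  by split => // /interior_subset.
have B01 : B = `[0, 1]%classic.
  apply: (@segment_connected R 0 1).
  - by exists 0; split; [rewrite /= in_itv/= lexx ler01|rewrite /preimage/= f0].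
  - by exists (f @^-1` D) => //; move/continuousP : cf; exact.
  - exists (f @^-1` closure D) => //; move/continuous_closedP : cf; apply.
    exact: closed_closure.
have : B 1 by rewrite B01 /= in_itv/= lexx ler01.
by move=> [_]; rewrite /preimage/= f1.
Qed.

Lemma compact_frontier : compact (frontier D).
Proof.
apply: bounded_closed_compact; last first.
  by apply: closedI; [exact: closed_closure|exact/open_closedC/open_interior].
case: bD => M [Mreal DM]; exists M; split => // N MN.
have cN : closed [set x : 'rV[R]_n | `|x| <= N].
  have /continuous_closedP/(_ [set y | y <= N]) := @norm_continuous R 'rV[R]_n.
  by apply; exact: closed_le.
have DN : D `<=` [set x : 'rV[R]_n | `|x| <= N] by exact: DM.
by move=> x [/(closureS DN) + _]; rewrite -(closure_id _).1.
Qed.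

(** A point that escapes by [y] is within [enorm y] of the frontier, which is compact. This is used
    for the sum of a partition of unity, with [c = 1]. *)
Lemma near_frontier (f : 'rV[R]_n -> R) (c e : R) : continuous f ->
  (forall x, frontier D x -> f x = c) -> 0 < e ->
  exists2 d, 0 < d & forall x y, enorm y < d -> escape D y x -> `|f x - c| < e.
Proof.
move=> cf fc e0.
pose U := [set x | `|f x - c| < e].
have oU : open U.
  have cg : continuous (fun x => `|f x - c|).
    move=> x; apply: (@continuous_comp _ _ _ f (fun y : R => `|y - c|)); first exact: cf.
    apply: (@continuous_comp _ _ _ (fun y : R => y - c) Num.norm).
      by apply: cvgB; [exact: cvg_id|exact: cvg_cst].
    exact: norm_continuous.
  by move/continuousP : cg => /(_ [set y | y < e]); apply; exact: open_lt.
have FU : frontier D `<=` U by move=> x /fc fx; rewrite /U/= fx subrr normr0.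
have [d d0 dU] := compact_open_margin compact_frontier oU FU.
exists d => // x y yd /escape_crossing[t /andP[t0 t1] Ft].
have -> : x = (x + t *: y) + (- t) *: y by rewrite scaleNr addrK.
apply: dU => //; apply: le_lt_trans yd.
by rewrite enormZ normrN ger0_norm// ler_piMl ?enorm_ge0.
Qed.

Lemma lebesgue_bounded_open : (lebesgue_rV n D < +oo)%E.
Proof.
case: bD => M [Mreal DM].
apply: (@lebesgue_rV_bounded _ _ _ (\sum_(i < n) (M + 1))).
  exact: open_measurable_rV.
move=> x Dx; apply: le_trans (ler_enorm_sum x) _; apply: ler_sum => i _.
have := DM (M + 1); rewrite ltrDl ltr01 => /(_ isT x Dx); apply: le_trans.
by rewrite [leRHS]/Num.norm /= mx_normrE; apply/bigmax_geP; right; exists (ord0, i).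
Qed.

Lemma lebesgue_escape_fin y : lebesgue_rV n (escape D y) \is a fin_num.
Proof.
rewrite ge0_fin_numE//; apply: le_lt_trans lebesgue_bounded_open.
have mD : measurable D by exact: open_measurable_rV.
apply: le_measure; rewrite ?inE//; first exact: measurable_escape.
by move=> x [].
Qed.

End boundary_layer.

(** * Assembling the charts by the partition of unity *)

Section chart_sum.
Context {R : realType} (n : nat) (D : set 'rV[R]_n.+1).
Hypotheses (oD : open D) (bD : bounded_set D).
Variables (k : nat) (r Lambda : 'I_k -> R) (z : 'I_k -> 'rV[R]_n.+1)
    (Q : 'I_k -> 'M[R]_n.+1) (phi : 'I_k -> 'rV[R]_n -> R)
    (chi : 'I_k -> 'rV[R]_n.+1 -> R).
Hypotheses (chartD : forall i, [/\ 0 < r i, 0 < Lambda i, frontier D (z i) &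
      C11_chart D (r i) (Lambda i) (z i) (Q i) (phi i)])
  (chiP : forall i, [/\ continuous (chi i), forall x, 0 <= chi i x &
      closure [set x | chi i x != 0] `<=` eball (z i) (r i)])
  (chi1 : forall x, frontier D x -> \sum_i chi i x = 1).

Let mD : measurable D. Proof. exact: open_measurable_rV. Qed.
Let cchi i : continuous (chi i). Proof. by case: (chiP i). Qed.
Let chi0 i x : 0 <= chi i x. Proof. by case: (chiP i). Qed.
Let G y := fine (lebesgue_rV n.+1 (escape D y)).
Let GE y : lebesgue_rV n.+1 (escape D y) = (G y)%:E.
Proof. by rewrite fineK//; exact: lebesgue_escape_fin. Qed.
Let G0 y : 0 <= G y. Proof. exact: fine_ge0. Qed.

Let W y : \bar R := (\sum_i weighted_escape D (chi i) y)%E.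

(** Escaping points are near the frontier, where the weights sum to almost 1. The error is relative
    to [G], and so survives the division by a small scale. *)
Let W_close e : 0 < e -> e <= 1 -> exists2 d, 0 < d & forall y, enorm y < d ->
  (((1 - e) * G y)%:E <= W y <= ((1 + e) * G y)%:E)%E.
Proof.
move=> e0 e1.
have cs : continuous (fun x => \sum_i chi i x) by exact: continuous_fsum.
have [d d0 dF] := near_frontier oD bD cs chi1 e0.
exists d => // y yd.
have mE : measurable (escape D y) by exact: measurable_escape.
have m1 : measurable_fun setT (\1_(escape D y) : 'rV[R]_n.+1 -> R).
  exact: measurable_indic.
have ms : measurable_fun setT (fun x => \sum_i chi i x).
  exact: continuous_measurable_rV.
have WE : W y = (\int[lebesgue_rV n.+1]_x ((\sum_i chi i x) * \1_(escape D y) x)%:E)%E.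
  rewrite /W /weighted_escape -ge0_integral_sum//.
  - by apply: eq_integral => x _; rewrite mulr_suml -sumEFin.
  - move=> i; apply/measurable_EFinP/measurable_funM => //.
    exact: continuous_measurable_rV.
  - by move=> i x _; rewrite lee_fin mulr_ge0.
have cE c : 0 <= c -> (\int[lebesgue_rV n.+1]_x (c * \1_(escape D y) x)%:E)%E = (c * G y)%:E.
  move=> c0; under eq_integral do rewrite EFinM.
  rewrite ge0_integralZl//; last by exact/measurable_EFinP.
  by rewrite integral_indic// setIT EFinM; congr (_ * _)%E; exact: GE.
have e10 : 0 <= 1 + e by rewrite addr_ge0// ltW.
have mc (c : R) : measurable_fun setT (fun x => (c * \1_(escape D y) x)%:E).
  exact/measurable_EFinP/measurable_funM.
have mS : measurable_fun setT (fun x => ((\sum_i chi i x) * \1_(escape D y) x)%:E).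
  exact/measurable_EFinP/measurable_funM.
rewrite WE -!cE ?subr_ge0//; apply/andP; split; apply: ge0_le_integral => //.
- by move=> x _; rewrite lee_fin mulr_ge0// subr_ge0.
- move=> x _; rewrite lee_fin indicE; have [xE|_] := boolP (x \in escape D y); last by rewrite !mulr0.
  rewrite inE in xE; rewrite /= !mulr1; have := dF x y yd xE.
  by rewrite ltr_distl => /andP[/ltW].
- by move=> x _; rewrite lee_fin mulr_ge0// sumr_ge0.
- move=> x _; rewrite lee_fin indicE; have [xE|_] := boolP (x \in escape D y); last by rewrite !mulr0.
  rewrite inE in xE; rewrite /= !mulr1; have := dF x y yd xE.
  by rewrite ltr_distl => /andP[_ /ltW].
Qed.

Let chartE i := let: And4 _ L0 _ cD := chartD i in
  let: And3 cc c0 cr := chiP i in conj L0 (conj cD (conj cc (conj c0 cr))).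

Lemma ex_pos_lower_bound (d : 'I_k -> R) : (forall i, 0 < d i) ->
  exists2 e, 0 < e & forall i, e <= d i.
Proof.
move=> d0; exists (\big[Order.min/1]_i d i); last by move=> i; exact: bigmin_le.
by apply: lt_bigmin.
Qed.

(** The bound must hold for all [y], since it will be applied to the unbounded [Z]. Short
    translations are controlled by the charts; for [m <= |y|] the volume [V] of [D] is at most
    [V / m * |y|]. *)
Lemma lebesgue_escape_le : exists2 C, 0 <= C & forall y, G y <= C * enorm y.
Proof.
have /choice[C /choice[d Cd]] : forall i, exists C, exists d, [/\ 0 <= C, 0 < d &
    forall y, enorm y < d -> (weighted_escape D (chi i) y <= (C * enorm y)%:E)%E].
  move=> i; have [L0 [cD [cc [c0 cr]]]] := chartE i.
  by have [C [d [? ? ?]]] := weighted_escape_le mD cD L0 cc c0 cr; exists C, d.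
have h0 : 0 < 2^-1 :> R by rewrite invr_gt0.
have h1 : 2^-1 <= 1 :> R by rewrite invf_le1// ler1n.
(* With [e = 1/2] this gives [G <= 2 W], whence the factor 2 in the constant. *)
have [d1 d10 d1W] := W_close h0 h1.
have [d2 d20 d2d] : exists2 e, 0 < e & forall i, e <= d i.
  by apply: ex_pos_lower_bound => i; have [] := Cd i.
pose m := Num.min d1 d2.
have m0 : 0 < m by rewrite lt_min d10.
have C0 i : 0 <= C i by have [] := Cd i.
pose V := fine (lebesgue_rV n.+1 D).
have V0 : 0 <= V by exact: fine_ge0.
have sC0 : 0 <= 2 * \sum_i C i by rewrite mulr_ge0// sumr_ge0.
exists (2 * (\sum_i C i) + V / m); first by rewrite addr_ge0// divr_ge0// ltW.
move=> y; rewrite mulrDl; have [ym|ym] := ltP (enorm y) m.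
  rewrite -[leLHS]addr0 lerD//; last by rewrite mulr_ge0 ?enorm_ge0// divr_ge0// ltW.
  move: ym; rewrite lt_min => /andP[y1 y2].
  have /andP[+ _] := d1W _ y1.
  have Wle : (W y <= ((\sum_i C i) * enorm y)%:E)%E.
    rewrite mulr_suml -sumEFin; apply: lee_sum => i _.
    by have [_ _] := Cd i; apply; exact: lt_le_trans (d2d i).
  move=> /le_trans/(_ Wle); rewrite lee_fin; lra.
have sCy : 0 <= 2 * (\sum_i C i) * enorm y by rewrite mulr_ge0 ?enorm_ge0.
rewrite -[leLHS]add0r lerD//.
apply: (@le_trans _ _ V).
  have Dfin : lebesgue_rV n.+1 D \is a fin_num.
    by rewrite ge0_fin_numE//; exact: lebesgue_bounded_open.
  have GV : (lebesgue_rV n.+1 (escape D y) <= lebesgue_rV n.+1 D)%E.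
    by apply: le_measure; rewrite ?inE//; [exact: measurable_escape|move=> x []].
  by move: GV; rewrite GE -[X in (_ <= X)%E](fineK Dfin) lee_fin.
by rewrite mulrAC ler_pdivlMr// ler_wpM2l.
Qed.

(** The rescaled [W] converges chart by chart, and [G] follows because its relative distance to [W]
    tends to 0. *)
Lemma lebesgue_escape_cvg y (s : R^nat) : (forall j, 0 < s j) ->
  s j @[j --> \oo] --> 0 ->
  ((s j)^-1%:E * (G (s j *: y))%:E)%E @[j --> \oo] -->
    (\sum_i surface_flux (z i) (Q i) (phi i) (chi i) y)%E.
Proof.
move=> s0 s_0.
have flux i : surface_flux (z i) (Q i) (phi i) (chi i) y \is a fin_num /\
  ((s j)^-1%:E * weighted_escape D (chi i) (s j *: y))%E @[j --> \oo] -->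
    surface_flux (z i) (Q i) (phi i) (chi i) y.
  have [L0 [cD [cc [c0 cr]]]] := chartE i.
  exact: (weighted_escape_cvg mD cD L0 cc c0 cr y s0 s_0).
pose ell := \sum_i fine (surface_flux (z i) (Q i) (phi i) (chi i) y).
have -> : (\sum_i surface_flux (z i) (Q i) (phi i) (chi i) y)%E = ell%:E.
  by rewrite /ell -sumEFin; apply: eq_bigr => i _; rewrite fineK//; have [] := flux i.
have w0 i x : (0 <= weighted_escape D (chi i) x)%E.
  by apply: integral_ge0 => v _; rewrite lee_fin mulr_ge0.
have Wc : ((s j)^-1%:E * W (s j *: y))%E @[j --> \oo] --> ell%:E.
  have -> : (fun j => (s j)^-1%:E * W (s j *: y))%E =
      (fun j => \sum_i (s j)^-1%:E * weighted_escape D (chi i) (s j *: y))%E.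
    by apply/funext => j; rewrite ge0_sume_distrr.
  rewrite /ell -sumEFin; apply: cvg_nnesum => i _.
    by apply: nearW => j; rewrite mule_ge0// lee_fin invr_ge0 ltW.
  by have [fi] := flux i; rewrite fineK.
have sy : s j * enorm y @[j --> \oo] --> 0.
  by rewrite -(mul0r (enorm y)); apply: cvgM => //; exact: cvg_cst.
have close e : 0 < e -> e <= 1 -> \forall j \near \oo,
    (((1 - e) * G (s j *: y))%:E <= W (s j *: y) <= ((1 + e) * G (s j *: y))%:E)%E.
  move=> e0 e1; have [d d0 dW] := W_close e0 e1.
  have /cvgrPdist_lt/(_ _ d0) syd := sy.
  near=> j; apply: dW; rewrite enormZ gtr0_norm//.
  by apply: le_lt_trans (ler_norm _) _; rewrite -normrN -sub0r; near: j.
have Wfin : \forall j \near \oo, W (s j *: y) \is a fin_num.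
  near=> j; rewrite ge0_fin_numE ?sume_ge0//.
  have : (((1 - 1) * G (s j *: y))%:E <= W (s j *: y) <= ((1 + 1) * G (s j *: y))%:E)%E.
    by near: j; exact: close.
  by move=> /andP[_ /le_lt_trans]; apply; rewrite ltry.
pose l j := (s j)^-1 * fine (W (s j *: y)).
have lc : l j @[j --> \oo] --> ell.
  have : fine ((s j)^-1%:E * W (s j *: y))%E @[j --> \oo] --> ell.
    exact: fine_cvg Wc.
  apply: cvg_trans; apply: near_eq_cvg; near=> j.
  have : W (s j *: y) \is a fin_num by near: j.
  by rewrite /l; case: (W _).
apply: cvg_EFin; first exact: nearW.
rewrite -[ell]mul1r; apply: cvg_relative lc => e e0.
(* The bound 1/2 gives [g <= 2 w], and then [e' <= e / 2] gives [e' * g <= e * w]. *)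
pose e' := Num.min (e / 2) 2^-1.
have e'0 : 0 < e' by rewrite lt_min divr_gt0//= invr_gt0.
have e'h : e' <= 2^-1 by rewrite ge_min lexx orbT.
have e'e : e' <= e / 2 by rewrite ge_min lexx.
near=> j.
have Wj : W (s j *: y) \is a fin_num by near: j.
have : (((1 - e') * G (s j *: y))%:E <= W (s j *: y) <= ((1 + e') * G (s j *: y))%:E)%E.
  near: j; apply: close => //; apply: le_trans e'h _; lra.
rewrite -(fineK Wj) !lee_fin /l /= => /andP[W1 W2].
set g := G _ in W1 W2 *; set w := fine _ in W1 W2 *.
have g0 : 0 <= g by exact: G0.
have sj : 0 < (s j)^-1 by rewrite invr_gt0.
rewrite mul1r -mulrBr normrM gtr0_norm// mulrCA ler_wpM2l ?(ltW sj)//.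
have g2w : g <= 2 * w by nra.
rewrite ler_norml; apply/andP; split; nra.
Unshelve. all: by end_near. Qed.

End chart_sum.

(** * The expected loss *)

Section expected_flux.
Context {R : realType} (n : nat) d (Omega : measurableType d)
  (P : probability Omega R) (Z : Omega -> 'rV[R]_n.+1).
Hypotheses (mZ : measurable_fun setT Z)
  (Zlaw : forall A : 'I_n.+1 -> set R, (forall i, measurable (A i)) ->
    P [set w | forall i, A i (Z w 0 i)] = (\prod_i normal_prob 0 1 (A i))%E).

Lemma measurable_dotr2 d' (T : measurableType d') m (f g : T -> 'rV[R]_m) :
  measurable_fun setT f -> measurable_fun setT g ->
  measurable_fun setT (fun t => dotr (f t) (g t)).
Proof.
move=> /measurable_fun_rVP mf /measurable_fun_rVP mg.
by apply: measurable_sum => i; exact: measurable_funM.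
Qed.

(** The norm is at most the sum of the [|Z_i|], and [|Z_i|] is the sum of the positive parts of the
    products with [e_i] and [- e_i], whose means are known. *)
Lemma integrable_std_normal_enorm : P.-integrable setT (fun w => (enorm (Z w))%:E).
Proof.
have mE : measurable_fun setT (fun w => enorm (Z w)).
  have := continuous_measurable_rV (@continuous_enorm R n.+1).
  by move=> /measurableT_comp; apply.
pose p i w := Num.max (dotr (delta_mx 0 i) (Z w)) 0.
pose m i w := Num.max (dotr (- delta_mx 0 i) (Z w)) 0.
have mdot v : measurable_fun setT (fun w => Num.max (dotr v (Z w)) 0).
  apply: measurable_maxr => //.
  exact: (measurableT_comp (measurable_dotr v) mZ).
have dotE i w : dotr (delta_mx 0 i) (Z w) = Z w 0 i.
  rewrite /dotr (bigD1 i)//= mxE !eqxx mul1r big1 ?addr0// => j ji.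
  by rewrite mxE (negbTE ji) andbF mul0r.
have dotN i w : dotr (- delta_mx 0 i) (Z w) = - Z w 0 i.
  by rewrite -dotE /dotr -sumrN; apply: eq_bigr => j _; rewrite mxE mulNr.
apply/integrableP; split; first exact/measurable_EFinP.
apply: (@le_lt_trans _ _ (\int[P]_w (\sum_i ((p i w)%:E + (m i w)%:E)))%E).
  apply: ge0_le_integral => //.
  - by apply/measurableT_comp => //; exact/measurable_EFinP.
  - by apply: emeasurable_sum => i; apply: emeasurable_funD; apply/measurable_EFinP; exact: mdot.
  move=> w _; rewrite gee0_abs ?lee_fin ?enorm_ge0//.
  under eq_bigr do rewrite -EFinD.
  rewrite sumEFin lee_fin (le_trans (ler_enorm_sum _))//; apply: ler_sum => i _.
  rewrite /p /m dotE dotN; have [z0|z0] := leP 0 (Z w 0 i).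
    by rewrite ger0_norm// lerDl le_max lexx orbT.
  by rewrite ltr0_norm// add0r le_max lexx.
rewrite ge0_integral_sum//; last 2 first.
- by move=> i; apply: emeasurable_funD; apply/measurable_EFinP; exact: mdot.
- by move=> i w _; rewrite -EFinD lee_fin addr_ge0// le_max lexx orbT.
apply: lte_sum_pinfty => i _; rewrite ge0_integralD//; last 4 first.
- by move=> w _; rewrite lee_fin le_max lexx orbT.
- by apply/measurable_EFinP; exact: mdot.
- by move=> w _; rewrite lee_fin le_max lexx orbT.
- by apply/measurable_EFinP; exact: mdot.
by rewrite /p /m !(integral_std_normal_dot mZ Zlaw) -EFinD ltry.
Qed.

Section one_chart.
Variables (r Lambda : R) (z : 'rV[R]_n.+1) (D : set 'rV[R]_n.+1)
  (Q : 'M[R]_n.+1) (phi : 'rV[R]_n -> R) (chi : 'rV[R]_n.+1 -> R).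
Hypotheses (chartD : C11_chart D r Lambda z Q phi)
  (cchi : continuous chi) (chi0 : forall x, 0 <= chi x).

Let QQ : Q *m Q^T = 1%:M. Proof. by case: chartD. Qed.
Let phiP : C11_function Lambda phi. Proof. by case: chartD. Qed.

Let f (p : 'rV[R]_n * Omega) : \bar R :=
  (chi (chart_point z Q p.1 (phi p.1)) *
   Num.max (dotr (rV_snoc (grad phi p.1) (-1) *m Q) (Z p.2)) 0)%:E.

Let mchart : measurable_fun setT (fun u => chi (chart_point z Q u (phi u))).
Proof.
apply: (measurableT_comp (continuous_measurable_rV cchi)).
have mpu : measurable_fun setT (fun u : 'rV[R]_n => (phi u, u)).
  apply/measurable_fun_pairP; split; last exact: measurable_id.
  by apply: continuous_measurable_rV; exact: continuous_C11 phiP.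
exact: (measurableT_comp (@measurable_chart_point _ _ z Q) mpu).
Qed.

Let mnormal : measurable_fun setT (fun u => rV_snoc (grad phi u) (-1) *m Q).
Proof.
apply: (measurableT_comp (measurable_mulmxr Q)).
apply/measurable_fun_rVP => j; under eq_fun do rewrite mxE.
case: unliftP => [i _|_] /=; last exact: measurable_cst.
by apply: continuous_measurable_rV; exact: (continuous_grad phiP).
Qed.

Let mf : measurable_fun setT f.
Proof.
apply/measurable_EFinP/measurable_funM.
  by apply: (measurableT_comp mchart); exact: measurable_fst.
apply: measurable_maxr => //; apply: measurable_dotr2.
  by apply: (measurableT_comp mnormal); exact: measurable_fst.
by apply: (measurableT_comp mZ); exact: measurable_snd.
Qed.

Let f0 p : (0 <= f p)%E.
Proof. by rewrite lee_fin mulr_ge0// le_max lexx orbT. Qed.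

Lemma measurable_surface_flux :
  measurable_fun setT (fun w => surface_flux z Q phi chi (Z w)).
Proof. exact: (measurable_fun_fubini_tonelli_G (m1 := lebesgue_rV n) f mf f0). Qed.

Lemma surface_flux_ge0 y : (0 <= surface_flux z Q phi chi y)%E.
Proof. by apply: integral_ge0 => u _; rewrite lee_fin mulr_ge0// le_max lexx orbT. Qed.

(** After Tonelli, each unnormalized normal contributes its length over [sqrt (2 pi)], and this
    length is the area density in [chart_integral]. *)
Lemma integral_surface_flux :
  (\int[P]_w surface_flux z Q phi chi (Z w) =
   chart_integral z Q phi chi * ((Num.sqrt (2 * pi))^-1)%:E)%E.
Proof.
rewrite /surface_flux -(fubini_tonelli (m1 := lebesgue_rV n) (m2 := P) f mf f0).
rewrite /chart_integral -ge0_integralZr//; last 2 first.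
- apply/measurable_EFinP/measurable_funM; first exact: mchart.
  have mg : measurable_fun setT (fun u => enorm (grad phi u)).
    have mgr : measurable_fun setT (fun u => grad phi u).
      apply/measurable_fun_rVP => i.
      by apply: continuous_measurable_rV; exact: (continuous_grad phiP).
    exact: (measurableT_comp (continuous_measurable_rV (@continuous_enorm R n)) mgr).
  apply: (measurableT_comp (f := @Num.sqrt R)).
    by apply: continuous_measurable_fun; exact: sqrt_continuous.
  by apply: measurable_funD => //; exact: measurable_funX.
- by move=> u _; rewrite lee_fin mulr_ge0// sqrtr_ge0.
apply: eq_integral => u _; rewrite /f/=.
under eq_integral do rewrite EFinM.
rewrite ge0_integralZl//; last 3 first.
- apply/measurable_EFinP/measurable_maxr => //.
  exact: (measurableT_comp (measurable_dotr _) mZ).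
- by move=> w _; rewrite lee_fin le_max lexx orbT.
- by rewrite lee_fin.
rewrite (integral_std_normal_dot mZ Zlaw) -!EFinM mulrA; congr (_ * _ / _)%:E.
rewrite enorm_orth// -[LHS](ger0_norm (enorm_ge0 _)) -sqrtr_sqr enorm_snoc.
by rewrite sqrrN expr1n addrC.
Qed.

End one_chart.

Section all_charts.
Variables (D : set 'rV[R]_n.+1) (oD : open D) (bD : bounded_set D) (S : \bar R).
Hypothesis areaS : area_by_charts D S.

(** For each fixed [w] the rescaled volumes converge to the flux of [Z w]; they are dominated by
    [C |Z|], which is integrable. *)
Lemma expected_escape_cvg (s : R^nat) : (forall k, 0 < s k) ->
  s k @[k --> \oo] --> 0 ->
  (S * ((Num.sqrt (2 * pi))^-1)%:E)%E \is a fin_num /\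
  ((s k)^-1%:E * \int[P]_w lebesgue_rV n.+1 (escape D (s k *: Z w)))%E
    @[k --> \oo] --> (S * ((Num.sqrt (2 * pi))^-1)%:E)%E.
Proof.
move=> s0 s_0.
have [m [r [La [z [Q [phi [chi [chartD chiP chi1 SE]]]]]]]] := areaS.
have mD : measurable D by exact: open_measurable_rV.
have [C C0 GC] := lebesgue_escape_le oD bD chartD chiP chi1.
have Gfin y := lebesgue_escape_fin oD bD y.
pose F w := (\sum_i surface_flux (z i) (Q i) (phi i) (chi i) (Z w))%E.
have mflux i : measurable_fun setT (fun w => surface_flux (z i) (Q i) (phi i) (chi i) (Z w)).
  have [_ _ _ cD] := chartD i; have [cc c0 _] := chiP i.
  exact: (measurable_surface_flux cD cc c0).
have flux0 i y : (0 <= surface_flux (z i) (Q i) (phi i) (chi i) y)%E.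
  by have [_ c0 _] := chiP i; exact: surface_flux_ge0.
have EF : (\int[P]_w F w = S * ((Num.sqrt (2 * pi))^-1)%:E)%E.
  rewrite /F ge0_integral_sum// SE ge0_sume_distrl; last first.
    move=> i _; apply: integral_ge0 => u _; have [_ c0 _] := chiP i.
    by rewrite lee_fin mulr_ge0// sqrtr_ge0.
  apply: eq_bigr => i _; have [_ _ _ cD] := chartD i; have [cc c0 _] := chiP i.
  exact: (integral_surface_flux cD cc c0).
have mG k : measurable_fun setT (fun w => lebesgue_rV n.+1 (escape D (s k *: Z w))).
  by apply: (measurableT_comp (measurable_lebesgue_escape mD)); exact: measurable_rVZ.
have [|||||iF _ hc] := @dominated_convergence _ _ _ P setT measurableT
  (fun k w => (s k)^-1%:E * lebesgue_rV n.+1 (escape D (s k *: Z w)))%E F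
  (fun w => (C%:E * (enorm (Z w))%:E)%E).
- by move=> k; exact: emeasurable_funM.
- exact: emeasurable_sum.
- apply: aeW => w _.
  have := @lebesgue_escape_cvg _ _ _ oD bD _ _ _ _ _ _ _ chartD chiP chi1 (Z w) _ s0 s_0.
  by under eq_fun do rewrite fineK//.
- exact/integrableZl/integrable_std_normal_enorm.
- apply: aeW => w k _.
  have sk0 := s0 k.
  have sV0 : 0 <= (s k)^-1 by rewrite invr_ge0 ltW.
  rewrite gee0_abs; last by rewrite mule_ge0// lee_fin.
  rewrite -(fineK (Gfin _)) -!EFinM lee_fin.
  apply: le_trans (ler_wpM2l sV0 (GC _)) _.
  rewrite enormZ gtr0_norm// le_eqVlt; apply/orP; left.
  by apply/eqP; field; rewrite gt_eqF.
rewrite -EF; split; first exact: integrable_fin_num iF.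
move: hc; apply: cvg_trans; apply: near_eq_cvg; near=> k.
rewrite /= ge0_integralZl//; first exact: mG.
by rewrite lee_fin invr_ge0 ltW.
Unshelve. all: by end_near. Qed.

End all_charts.

End expected_flux.

(** * Existence of charts *)

Section bump.
Context {R : realType} (n : nat) (z : 'rV[R]_n) (r : R).

Definition bump (x : 'rV[R]_n) : R := Num.max 0 (r - enorm (x - z)).

Lemma bump_ge0 x : 0 <= bump x.
Proof. by rewrite le_max lexx. Qed.

Lemma continuous_bump : continuous bump.
Proof.
move=> x; apply: (@continuous_max R 'rV[R]_n (fun=> 0) (fun x => r - enorm (x - z))).
  exact: cst_continuous.
by apply: (@cvgB _ _ _ (nbhs x)); [exact: cvg_cst|exact: continuous_enorm_sub].
Qed.

Lemma closure_bump_support : closure [set x | bump x != 0] `<=` [set x | enorm (x - z) <= r].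
Proof.
rewrite [X in _ `<=` X](closure_id _).1; last first.
  have /continuous_closedP/(_ [set y | y <= r]) := @continuous_enorm_sub R n z.
  by apply; exact: closed_le.
apply: closureS => x /=; apply: contra_neqT; rewrite -ltNge => rx.
by apply/max_idPl; rewrite subr_le0 ltW.
Qed.

End bump.

Section charts_exist.
Context {R : realType} (n : nat) (D : set 'rV[R]_n.+1).

(** Three radii: [r / 2] for the cover, [3 / 4 * r] for the tents and [r] for the charts. A tent is
    at least [r / 4] on its ball of the cover, and its closed support stays in the ball of its
    chart. *)
Lemma area_by_charts_exists : bounded_set D -> C11_open D ->
  exists S, area_by_charts D S.
Proof.
move=> bD [oD [r [La [r0 La0 chartD]]]].
have := compact_frontier bD; rewrite compact_cover.
move=> /(_ _ (frontier D) (fun z => eball z (r / 2)))[||F FD Fcov].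
- by move=> z _; exact: open_eball.
- by move=> x Fx; exists x => //; rewrite /eball/= subrr enorm0 divr_gt0.
pose k := size (enum_fset F).
pose z (i : 'I_k) : 'rV[R]_n.+1 := nth 0 (enum_fset F) i.
have zF i : frontier D (z i).
  by apply/set_mem/FD; rewrite /z; exact: mem_nth.
have /choice[f fP] (i : 'I_k) :
    exists p : 'M[R]_n.+1 * ('rV[R]_n -> R), C11_chart D r La (z i) p.1 p.2.
  by have [Q [phi]] := chartD _ (zF i); exists (Q, phi).
pose psi i := bump (z i) (3 / 4 * r).
(* The floor [r / 4] keeps the denominator positive and continuous everywhere; on the frontier the
   sum is at least [r / 4], so there [N] is the sum itself. *)
pose N x := Num.max (\sum_i psi i x) (r / 4).
have N0 x : 0 < N x by rewrite lt_max divr_gt0// orbT.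
have cN : continuous N.
  move=> x; apply: (@continuous_max R 'rV[R]_n.+1 (fun x => \sum_i psi i x) (fun=> r / 4)).
    by apply: continuous_fsum => i; exact: continuous_bump.
  exact: cst_continuous.
pose chi i x := psi i x / N x.
exists (\sum_i chart_integral (z i) (f i).1 (f i).2 (chi i))%E.
exists k, (fun=> r), (fun=> La), z, (fun i => (f i).1), (fun i => (f i).2), chi.
split => //.
- move=> i; split.
  + move=> x; apply: (@cvgM _ _ (nbhs x)); first exact: continuous_bump.
    by apply: (@cvgV _ _ (nbhs x)); [rewrite gt_eqF|exact: cN].
  + by move=> x; rewrite divr_ge0 ?bump_ge0// ltW.
  + apply: (@subset_trans _ (closure [set x | psi i x != 0])).
      by apply: closureS => x /=; apply: contra_neq => px; rewrite /chi px mul0r.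
    apply: (subset_trans (@closure_bump_support _ _ _ _)) => x /=.
    by move=> /le_lt_trans; apply; rewrite gtr_pMl//; lra.
- move=> x /Fcov[y /= yF yx]; rewrite -mulr_suml.
  have yk : (index y (enum_fset F) < k)%N by rewrite index_mem.
  have zy : z (Ordinal yk) = y by rewrite /z /= nth_index.
  rewrite (_ : N x = \sum_i psi i x) ?divff//.
    rewrite gt_eqF// (@lt_le_trans _ _ (r / 4)) ?divr_gt0//.
    rewrite (bigD1 (Ordinal yk))//= ler_wpDr ?sumr_ge0// => [i _|]; first exact: bump_ge0.
    rewrite /psi /bump zy le_max; apply/orP; right.
    by move: yx; rewrite /eball/=; lra.
  apply/max_idPl; rewrite (bigD1 (Ordinal yk))//= ler_wpDr ?sumr_ge0// => [i _|].
    exact: bump_ge0.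
  rewrite /psi /bump zy le_max; apply/orP; right.
  by move: yx; rewrite /eball/=; lra.
Qed.

End charts_exist.

(** * Dimension one: the two ends of an interval as charts *)

Section interval.
Context {R : realType}.

Section interval_end.
Variables (D : set 'rV[R]_1) (c sg l : R).
Hypotheses (sg2 : sg * sg = 1) (l0 : 0 < l)
  (DE : forall h, D (const_mx (c + sg * h)) <-> 0 < h < l).

Lemma rV1E (x : 'rV[R]_1) : x = const_mx (x 0 0).
Proof. by apply/rowP => i; rewrite mxE ord1. Qed.

Lemma chart_point_interval (u : 'rV[R]_0) h :
  chart_point (const_mx c) sg%:M u h = const_mx (c + sg * h).
Proof.
rewrite /chart_point mul_mx_scalar; apply/rowP => j; rewrite !mxE ord1.
by case: unliftP => [[]//|_]; rewrite /= ?mxE.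
Qed.

Lemma enorm_rV1 (x : 'rV[R]_1) : enorm x = `|x 0 0|.
Proof. by rewrite /enorm big_ord_recl big_ord0 addr0 sqrtr_sqr. Qed.

Let normsg : `|sg| = 1.
Proof. by apply/eqP; rewrite -sqrp_eq1// real_normK ?num_real// expr2 sg2. Qed.

(** Here [c] is an end, [sg] the inward direction and [l] the length: small positive inward
    distances lie in [D], and distance 0 does not. *)
Lemma frontier_interval_end : frontier D (const_mx c).
Proof.
split; last first.
  move=> /interior_subset; rewrite -[c]addr0 -(mulr0 sg) => /DE.
  by rewrite ltxx.
move=> B /nbhs_ballP[e +]; rewrite /= => e0 eB.
have half (x : R) : 0 < x -> x / 2 < x by move=> x0; lra.
pose h := Num.min (e / 2) (l / 2).
have h0 : 0 < h by rewrite lt_min !divr_gt0.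
exists (const_mx (c + sg * h)); split.
  by apply/DE; rewrite h0 gt_min half ?orbT.
apply: eB; split => // i j; rewrite !mxE /ball/= opprD addrA subrr sub0r normrN normrM.
by rewrite normsg mul1r gtr0_norm// gt_min half.
Qed.

(** A graph over R^0 is one point, and within distance [l] of the end the interval is a
    half-line. *)
Lemma chart_interval_end : C11_chart D l 1 (const_mx c) sg%:M (fun=> 0).
Proof.
have g0 u : grad (fun=> 0) u = 0 :> 'rV[R]_0 by rewrite thinmx0.
split => //.
- by rewrite tr_scalar_mx mul_scalar_mx scale_scalar_mx sg2.
- split => [u|u|u v]; first exact: differentiable_cst.
    by rewrite g0 enorm0.
  by rewrite !g0 subrr enorm0 mul1r enorm_ge0.
have key h : eball (const_mx c : 'rV[R]_1) l (const_mx (c + sg * h)) ->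
    D (const_mx (c + sg * h)) <-> 0 < h.
  rewrite /eball/= enorm_rV1 !mxE addrC addKr normrM normsg mul1r => hl.
  split=> [/DE/andP[]//|h0]; apply/DE; rewrite h0/=.
  exact: le_lt_trans (ler_norm _) hl.
apply/seteqP; split => x [xl].
  have xE : x = const_mx (c + sg * (sg * (x 0 0 - c))).
    by rewrite mulrA sg2 mul1r subrKC -rV1E.
  rewrite {1 2}xE in xl *.
  move=> /(key _ xl) h0; split; first by rewrite xE.
  by exists 0, (sg * (x 0 0 - c)); split => //; rewrite chart_point_interval.
move=> [u [h [h0 xE]]]; rewrite xE chart_point_interval in xl *.
by split => //; apply/key.
Qed.

(** [lebesgue_rV 0] is a Dirac mass and gradients on R^0 vanish, so the integral is an
    evaluation. *)
Lemma chart_integral_interval_end (chi : 'rV[R]_1 -> R) :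
  chart_integral (const_mx c) sg%:M (fun=> 0) chi = (chi (const_mx c))%:E.
Proof.
rewrite /chart_integral (eq_integral (cst (chi (const_mx c))%:E)).
  by rewrite integral_cst//= diracT mule1.
move=> u _; rewrite chart_point_interval mulr0 addr0.
by rewrite (_ : grad _ _ = 0) ?enorm0 ?expr0n ?addr0 ?sqrtr1 ?mulr1// thinmx0.
Qed.

End interval_end.

(** Each end contributes area 1, in agreement with the value 2 set in [boundary_measure]. *)
Lemma interval_domain (a b : R) (D := [set x : 'rV[R]_1 | a < x 0 ord0 < b]) :
  a < b -> [/\ open D, bounded_set D & area_by_charts D 2%:E].
Proof.
move=> ab; have l0 : 0 < b - a by rewrite subr_gt0.
have oD : open D.
  rewrite (_ : D = (fun x : 'rV[R]_1 => x 0 ord0) @^-1` `]a, b[%classic).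
    by move/continuousP : (@coord_continuous R 1 1 0 ord0); apply; exact: interval_open.
  by apply/seteqP; split => x; rewrite /D/= in_itv.
split => //.
  apply: (@bounded_enorm _ _ _ (`|a| + `|b|)) => x /andP[ax xb].
  rewrite enorm_rV1 ler_norml; apply/andP; split.
    apply: le_trans (ltW ax); rewrite lerNl (le_trans (ler_norm _))// normrN.
    by rewrite lerDl.
  by apply: le_trans (ltW xb) _; rewrite (le_trans (ler_norm _))// lerDr.
pose c (i : 'I_2) := if i == 0 then a else b.
pose sg (i : 'I_2) : R := if i == 0 then 1 else -1.
have sg2 i : sg i * sg i = 1 by rewrite /sg; case: ifP; rewrite ?mulr1// mulrNN mulr1.
have DE i h : D (const_mx (c i + sg i * h)) <-> 0 < h < b - a.
  rewrite /D /= mxE /c /sg; case: ifP => _; split => /andP[? ?]; apply/andP; split; lra.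
(* At half the length each tent vanishes at the other end, and its support stays within the chart
   radius [b - a]. *)
pose rho := (b - a) / 2.
have rho0 : 0 < rho by rewrite divr_gt0.
pose z i : 'rV[R]_1 := const_mx (c i).
pose chi i x := bump (z i) rho x / rho.
have chiz i j : chi i (z j) = (i == j)%:R.
  rewrite /chi /bump enorm_rV1 !mxE; have [->|ij] := eqVneq i j.
    by rewrite subrr normr0 subr0 (max_idPr (ltW rho0)) divff// gt_eqF.
  rewrite (_ : `|c j - c i| = b - a); last first.
    move: ij; rewrite /c; case: i => -[|[|//]] ?; case: j => -[|[|//]] ? //= _.
      by rewrite gtr0_norm.
    by rewrite ltr0_norm ?opprB// subr_lt0.
  rewrite (max_idPl _) ?mul0r// /rho; lra.
exists 2%N, (fun=> b - a), (fun=> 1), z, (fun i => (sg i)%:M), (fun _ _ => 0), chi.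
split.
- move=> i; split => //.
    exact: (frontier_interval_end (sg2 i) l0 (DE i)).
  exact: (chart_interval_end (sg2 i) (DE i)).
- move=> i; split.
  + move=> x; apply: (@cvgM _ _ (nbhs x)); first exact: continuous_bump.
    exact: cvg_cst.
  + by move=> x; rewrite divr_ge0 ?bump_ge0// ltW.
  + apply: (@subset_trans _ (closure [set x | bump (z i) rho x != 0])).
      by apply: closureS => x /=; apply: contra_neq => px; rewrite /chi px mul0r.
    apply: (subset_trans (@closure_bump_support _ _ _ _)) => x /=.
    by move=> /le_lt_trans; apply; rewrite /rho; lra.
- move=> x [xD nDx].
  have {}nDx : ~ D x by rewrite -((interior_id _).1 oD).
  have /andP[ax xb] : a <= x 0 ord0 <= b.
    have cl : closed [set x : 'rV[R]_1 | a <= x 0 ord0 <= b].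
      rewrite (_ : [set _ | _] = (fun x : 'rV[R]_1 => x 0 ord0) @^-1` `[a, b]%classic).
        have /continuous_closedP := @coord_continuous R 1 1 0 ord0; apply.
        exact: interval_closed.
      by apply/seteqP; split => y; rewrite /= in_itv.
    have : closure D `<=` [set x : 'rV[R]_1 | a <= x 0 ord0 <= b].
      rewrite [X in _ `<=` X](closure_id _).1//; apply: closureS => y.
      by rewrite /D/= => /andP[/ltW -> /ltW ->].
    exact.
  have [i ->] : exists i, x = z i.
    have [xa|xa] := eqVneq (x 0 0) a.
      by exists 0; rewrite (rV1E x) xa.
    have [xb'|xb'] := eqVneq (x 0 0) b.
      by exists 1; rewrite (rV1E x) xb'.
    exfalso; apply: nDx; rewrite /D/=.
    by rewrite lt_neqAle eq_sym xa ax /= lt_neqAle xb' xb.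
  by rewrite (bigD1 i)//= chiz eqxx big1 ?addr0// => j /negbTE ji; rewrite chiz ji.
- rewrite (eq_bigr (fun=> 1%:E)).
    by rewrite !big_ord_recl big_ord0 adde0.
  by move=> i _; rewrite chart_integral_interval_end chiz eqxx.
Qed.

End interval.

(** In higher dimension [xget] returns an area computed from charts as soon as one exists. *)
Lemma admissible_domain_charts {R : realType} n (D : set 'rV[R]_n.+1) :
  admissible_domain D ->
  [/\ open D, bounded_set D & area_by_charts D (boundary_measure D)].
Proof.
case=> [[n0 [a [b [ab DE]]]]|[n0 [_ bD _ CD]]].
  by move: D DE; rewrite n0 => D ->; exact: interval_domain.
split => //; first by case: CD.
case: n D n0 bD CD => // n D _ bD CD.
by have /(xgetPex 0%E) := area_by_charts_exists bD CD.
Qed.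

(** * The limit *)

Theorem theorem3p1 (R : realType) (n : nat) (D : set 'rV[R]_n.+1)
    (d : measure_display) (Omega : measurableType d) (P : probability Omega R)
    (X : R -> Omega -> 'rV[R]_n.+1)
    (D_adm : admissible_domain D)
    (X_meas : forall t : R, 0 <= t <= 1 -> measurable_fun setT (X t))
    (X_cadlag : forall w, cadlag (fun t => X t w))
    (X_start : P [set w | X 0 w = 0] = 1%E)
    (X_indep : independent_processes P (component X))
    (X_ident : identically_distributed P (component X))
    (X_gauss : forall i, gaussian_process P (component X i))
    (X_mean : forall i, zero_mean P (component X i))
    (X_nondeg : forall t : R, 0 < t <= 1 ->
      (0 < P [set w | X t w <> 0%R])%E) :
  ((lebesgue_rV n.+1 D - heat_content P D X t) *
     ((Num.sqrt (variance_function P X t))^-1)%:E)%E @[t --> 0^'+] -->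
  (boundary_measure D * ((Num.sqrt (2 * pi))^-1)%:E)%E.
Proof.
have [oD bD areaD] := admissible_domain_charts D_adm.
have mD : measurable D by exact: open_measurable_rV.
have Doo := lebesgue_bounded_open oD bD.
pose sd t := Num.sqrt (variance_function P X t).
have sd0 t : 0 < t <= 1 -> 0 < sd t.
  move=> t01; rewrite sqrtr_gt0.
  exact: (variance_function_gt0 X_meas X_ident X_gauss X_mean X_nondeg).
pose Z := normalized_end P X.
have mZ : measurable_fun setT Z by exact: measurable_normalized_end.
have Zlaw := normalized_end_law X_meas X_indep X_ident X_gauss X_mean X_nondeg.
have mE := measurable_lebesgue_escape mD.
have deficitE t : 0 < t <= 1 ->
    ((lebesgue_rV n.+1 D - heat_content P D X t) * (sd t)^-1%:E =
     (sd t)^-1%:E * \int[P]_w lebesgue_rV n.+1 (escape D (sd t *: Z w)))%E.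
  move=> t01; have t01' : 0 <= t <= 1 by move: t01 => /andP[/ltW -> ->].
  have mXt := X_meas t t01'.
  have mW : measurable_fun setT (fun w => sd t *: Z w) by exact: measurable_rVZ.
  rewrite muleC; congr (_ * _)%E; rewrite /heat_content (heat_deficit mD P mXt Doo).
  have escape0 y : (0 <= lebesgue_rV n.+1 (escape D y))%E by exact: measure_ge0.
  (* Both integrals are carried to the law of [sd t *: Z], shared by [X t]. *)
  have lawX := process_law X_meas X_indep X_ident X_gauss X_mean X_nondeg t01.
  rewrite (ge0_integral_law (nu := pushforward P (fun w => sd t *: Z w)) mXt lawX mE escape0).
  by rewrite (ge0_integral_law (nu := pushforward P (fun w => sd t *: Z w)) mW _ mE escape0).
have limit (t : R^nat) : (forall k, 0 < t k <= 1) -> t k @[k --> \oo] --> 0 ->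
    (boundary_measure D * ((Num.sqrt (2 * pi))^-1)%:E)%E \is a fin_num /\
    ((sd (t k))^-1%:E * \int[P]_w lebesgue_rV n.+1 (escape D (sd (t k) *: Z w)))%E
      @[k --> \oo] --> (boundary_measure D * ((Num.sqrt (2 * pi))^-1)%:E)%E.
  move=> t01 t_0.
  apply: (expected_escape_cvg mZ Zlaw oD bD areaD) => [k|]; first exact: sd0.
  exact: (cvg_sd X_meas X_cadlag X_start X_indep X_ident X_gauss X_mean X_nondeg t01 t_0).
(* One sequence is enough to see that the limit is finite; the sequential criterion used next speaks
   of a real limit. *)
have [|/fineK <- _] := limit (fun k => k.+1%:R^-1) _ (@cvg_harmonic R).
  by move=> k; rewrite invr_gt0 ltr0Sn invf_le1 ?ltr0Sn// ler1n.
apply/cvge_at_rightP => u [u0 u_0].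
(* The first terms of [u] may exceed 1, where nothing is known of the process; the cap changes only
   finitely many terms. *)
pose t k := Num.min (u k) 1.
have t01 k : 0 < t k <= 1 by rewrite lt_min u0 ltr01/= ge_min lexx orbT.
have tu : \forall k \near \oo, t k = u k.
  have : \forall k \near \oo, u k < 1 by apply: (cvgr_lt 0 u_0); exact: ltr01.
  by apply: filterS => k /ltW /min_idPl.
have t_0 : t k @[k --> \oo] --> 0.
  by apply: cvg_trans u_0; apply: near_eq_cvg; apply: filterS tu => k ->.
have [lfin] := limit t t01 t_0; rewrite fineK//; apply: cvg_trans.
apply: near_eq_cvg; apply: filterS tu => k tuk; rewrite -tuk.
exact/esym/deficitE.
Qed.
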